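(* Let $D$ be a B-regular domain in $\mathbb{C}^n$. Let $A\subset\partial D$ be b-pluripolar, let $F$ be an $F_\sigma$ set and $G$ a $G_\delta$ set in $\overline D$ such that $F\subset\hat A\subset G$. Then there exist a set $E\subset\overline D$ and a negative function $\psi\in\mathrm{PSH}(D)$ such that $F\subset E\subset G$, where $E=\{z\in\overline D:\ \psi^*(z)=-\infty\}$.
   Context: $\mathrm{PSH}(D)$ denotes the family of all plurisubharmonic functions on $D$. For $u:D\to\mathbb{R}\cup\{-\infty\}$ and $x\in\overline D$, $u^*(x)=\limsup_{z\to x,\,z\in D}u(z)=\lim_{r\to0}\sup_{B(x,r)\cap D}u$. A bounded domain $D\subset\mathbb{C}^n$ is B-regular if every $f\in C(\partial D)$ can be extended to a plurisubharmonic function on $D$ that is continuous on $\overline D$. A set $A\subset\partial D$ is b-pluripolar if there exists $u\in\mathrm{PSH}(D)$, $u\le0$, $u\not\equiv-\infty$, such that $u^*=-\infty$ on $A$. The b-pluripolar hull of a b-pluripolar set $A\subset\partial D$ is $$\hat A=\{z\in\overline D:\ u^*(z)=-\infty\text{ for all }u\in\mathrm{PSH}(D)\text{ with }u\not\equiv-\infty,\ u<0,\ u^*|_A=-\infty\}.$$ *)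

(* Defs.v *)
From HB Require Import structures.
From mathcomp Require Export all_boot all_order all_algebra.
From mathcomp Require Export complex.
From mathcomp Require Export all_classical all_reals all_analysis.
From mathcomp Require Export borel_hierarchy.
Export Order.TTheory GRing.Theory Num.Theory.
Export numFieldNormedType.Exports.

Set Implicit Arguments.
Unset Strict Implicit.
Unset Printing Implicit Defensive.

Local Open Scope classical_set_scope.
Local Open Scope ring_scope.
Local Open Scope complex_scope.

(* The complex numbers R[i] do not come with a topology: give them the one
   induced by the modulus.  The space C^n is then 'rV[R[i]]_n, whose norm is
   the sup norm; only its topology and its bounded sets are used below. *)
HB.instance Definition _ (R : rcfType) := NormedModule.copy R[i] R[i]^o.

(* Functions on a subset D of C^n with values in R \cup {-oo} are represented
   by total functions to \bar R; only their values on D are ever used. *)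

Section Topology.
Context {R : realType} {T : topologicalType}.
Implicit Types (A D : set T) (u : T -> \bar R).

Definition frontier A : set T := closure A `\` A°.

Definition domain D := [/\ open D, connected D & D !=set0].

Definition usc_on D u := forall x, D x -> forall a : R, (u x < a%:E)%E ->
  \forall y \near within D (nbhs x), (u y < a%:E)%E.

(* u^*(x) = limsup_(z -> x, z \in D) u(z), where z = x is allowed if x \in D. *)
Definition usc_ext D u (x : T) : \bar R := limf_esup u (within D (nbhs x)).

End Topology.

Section Plurisubharmonic.
Context {R : realType}.

(* v c is at most the mean of v over every circle bounding a closed disc
   contained in V.  As v is bounded above on such a circle, the integral is
   well defined, with value in [-oo, +oo[.  The function -oo is allowed. *)
Definition subharmonic (V : set R[i]) (v : R[i] -> \bar R) :=
  [/\ usc_on V v,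
      forall z, V z -> (v z < +oo)%E &
      forall (c : R[i]) (r : R), 0 < r -> [set z | `|z - c| <= r%:C] `<=` V ->
        (v c <= ((2 * pi)^-1)%:E *
          \int[@lebesgue_measure R]_(t in `[0%R, (2 * pi)%R])
            v (c + r%:C * (cos t +i* sin t)%C)%R)%E].

Context {n : nat}.
Implicit Types (D A : set 'rV[R[i]]_n) (u : 'rV[R[i]]_n -> \bar R).

Definition psh D u :=
  [/\ usc_on D u,
      forall z, D z -> (u z < +oo)%E &
      forall a b : 'rV[R[i]]_n,
        subharmonic [set l | D (a + l *: b)] (fun l => u (a + l *: b))].

Definition not_identically_ninfty D u := exists2 z, D z & u z != -oo%E.

Definition B_regular D :=
  [/\ domain D, bounded_set D &
      forall f : 'rV[R[i]]_n -> R, {within frontier D, continuous f} ->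
        exists g : 'rV[R[i]]_n -> R,
          [/\ {within closure D, continuous g},
              psh D (EFin \o g) &
              {in frontier D, g =1 f}]].

Definition b_pluripolar D A :=
  A `<=` frontier D /\
  exists u, [/\ psh D u,
                forall z, D z -> (u z <= 0)%E,
                not_identically_ninfty D u &
                forall z, A z -> usc_ext D u z = -oo%E].

Definition b_pluripolar_hull D A : set 'rV[R[i]]_n :=
  [set z | closure D z /\
    forall u, psh D u -> not_identically_ninfty D u ->
      (forall w, D w -> (u w < 0)%E) ->
      (forall w, A w -> usc_ext D u w = -oo%E) ->
      usc_ext D u z = -oo%E].

End Plurisubharmonic.

(* Main.v *)
Require Import Defs.
From mathcomp Require Import ring lra zify measurable_realfun.

(** Write F as an increasing union of compact sets F_m, and the complement of G
    in the closure of D as an increasing union of compact sets K_m, which avoid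
    the hull. The function psi is -1 plus a series of continuous plurisubharmonic
    functions v_m with values in [-1, 0], where v_m < -1/2 near F_m and
    v_m > - 2^-m near K_m. The first property makes psi^* = -oo on F; the second
    one should keep psi^* finite on every K_m.

    Each v_m comes from the definition of the hull. A point p of K_m is outside
    the hull, so there is a negative plurisubharmonic u with u^* = -oo on the
    hull, in particular on F_m, and u^*(p) > -oo. Take a large T and a continuous
    phi with values in [-T, 0] that is above u and below - T/2 on F_m. The largest
    plurisubharmonic function V below phi is above u, so V / T is close to 0 at
    points of D close to p; it is less than -1/2 near F_m because phi / T is. In a
    B-regular domain V is uniformly continuous (Walsh's theorem,
    [walsh_envelope]), so the bound holds in a neighborhood of p, and finitely
    many functions V / T, combined by a maximum, serve the whole of K_m
    ([separate_point], [tame_compact]).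

    Walsh's theorem compares the envelope with its translates: a translate of a
    member of the family, lowered by a small constant, can be glued near the
    frontier to a function that is almost phi there. B-regularity provides this
    barrier ([lower_barrier]). The glued function satisfies the submean
    inequality on small discs only, and [psh_of_local] extends it to all discs
    by averaging over rotations and applying the maximum principle.

    The last point is that psi^* sees only the values of psi in D, while K_m may
    lie in the frontier and the neighborhoods on which v_m > - 2^-m shrink with m.
    But psi^* is upper semicontinuous, so it suffices to bound psi from below
    along points of D that accumulate at every point of K_m. The points of D
    outside the hull are dense, since a plurisubharmonic function that is -oo on
    a ball is -oo on all of D ([psh_ninfty_nbhs]). The functions v_m are also
    made close to 0 on nets of such points, and a sparse enough subsequence of
    the v_m then works ([exhausting_psh]). *)

Set Implicit Arguments.
Unset Strict Implicit.
Unset Printing Implicit Defensive.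

Local Open Scope classical_set_scope.
Local Open Scope ring_scope.
Local Open Scope complex_scope.

(** * Compactness and semicontinuity *)

Section CompactInduction.
Context {T : topologicalType}.

(** Finite subcovers without covers: a property of sets that passes to subsets
    and to finite unions holds on a compact set as soon as it holds locally.
    If it failed on K, the complements of the sets having it would generate a
    proper filter on K, and this filter could not cluster anywhere. *)
Lemma compact_ind (K : set T) (P : set T -> Prop) : compact K ->
  P set0 -> (forall A B, A `<=` B -> P B -> P A) ->
  (forall A B, A `<=` K -> B `<=` K -> P A -> P B -> P (A `|` B)) ->
  (forall x, K x -> exists2 U, nbhs x U & P (K `&` U)) -> P K.
Proof.
move=> cK P0 Psub PU Ploc; apply: contrapT => nPK.
pose F : set_system T := [set A | P (K `\` A)].
have FF : ProperFilter F.
  split; first by rewrite /F /= setD0.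
  split; first by rewrite /F /= setDT.
    by move=> A B FA FB; rewrite /F /= setDIr; apply: PU => // x [].
  by move=> A B AB; apply: Psub => x [? nB]; split => // /AB.
have FK : F K by rewrite /F /= setDv.
have [x [Kx clx]] := cK F FF FK.
have [U Ux PKU] := Ploc x Kx.
have FU : F (~` U) by apply: Psub PKU => y [Ky /contrapT].
by have [y [nUy Uy]] := clx _ _ FU Ux.
Qed.

End CompactInduction.

Section UscMax.
Context {R : realType} {T : topologicalType}.
(** If no point were a maximizer, every point would have a neighborhood on
    which f stays below some value f y, and finitely many such bounds would give
    f y < f y for the best of them. *)
Lemma usc_compact_max (K : set T) (f : T -> R) : compact K -> K !=set0 ->
  usc_on K (EFin \o f) -> exists2 x, K x & forall y, K y -> f y <= f x.
Proof.
move=> cK [x0 Kx0] uf; apply: contrapT => nmax.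
have hi x : K x -> exists2 y, K y & f x < f y.
  move=> Kx; apply: contrapT => nx; apply: nmax; exists x => // y Ky.
  by rewrite leNgt; apply/negP => lt; apply: nx; exists y.
have [y Ky] : exists2 y, K y & forall s, K s -> f s < f y.
  apply: (@compact_ind _ K (fun S => exists2 y, K y &
      forall s, S s -> f s < f y)) => //.
  - by exists x0.
  - by move=> A B AB [y Ky By]; exists y => // s /AB; exact: By.
  - move=> A B _ _ [y Ky Ay] [z Kz Bz].
    case: (leP (f y) (f z)) => yz; [exists z | exists y] => // s [As|Bs].
    + by apply: lt_le_trans yz; exact: Ay.
    + exact: Bz.
    + exact: Ay.
    + by apply: lt_trans yz; exact: Bz.
  - move=> x Kx; have [y Ky xy] := hi _ Kx.
    exists [set s | K s -> f s < f y]; last by exists y => // s [Ks]; exact.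
    have := uf x Kx (f y); rewrite lte_fin => /(_ xy) H.
    by apply: (filterS _ H) => s /=; rewrite lte_fin.
by move=> /(_ y Ky); rewrite ltxx.
Qed.
End UscMax.

Section UscSum.
Context {R : realType} {T : topologicalType}.
Implicit Types (K : set T) (f g : T -> R).
Lemma usc_onD K f g : usc_on K (EFin \o f) -> usc_on K (EFin \o g) ->
  usc_on K (EFin \o (fun x => f x + g x)).
Proof.
move=> uf ug x Kx c /=; rewrite lte_fin => fgc.
pose e := (c - (f x + g x)) / 2.
have e0 : 0 < e by rewrite divr_gt0 // subr_gt0.
have := uf x Kx (f x + e); rewrite lte_fin ltrDl => /(_ e0) hf.
have := ug x Kx (g x + e); rewrite lte_fin ltrDl => /(_ e0) hg.
near=> y; rewrite /= lte_fin.
have hfy : f y < f x + e by rewrite -lte_fin; near: y.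
have hgy : g y < g x + e by rewrite -lte_fin; near: y.
have : 2 * e = c - (f x + g x) by rewrite mulrC divfK.
by lra.
Unshelve. all: by end_near. Qed.

Lemma usc_on_sum K N (f : 'I_N -> T -> R) : (forall i, usc_on K (EFin \o f i)) ->
  usc_on K (EFin \o (fun x => \sum_(i < N) f i x)).
Proof.
elim: N f => [|N IH] f uf.
  by move=> x _ c /=; rewrite big_ord0 => c0; apply: nearW => y /=; rewrite big_ord0.
have -> : (fun x => \sum_(i < N.+1) f i x) = (fun x => f ord0 x + \sum_(i < N) f (lift ord0 i) x).
  by apply/funext => x; rewrite big_ord_recl.
by apply: usc_onD => //; exact: IH.
Qed.

Lemma usc_on_continuous K f : {within K, continuous f} -> usc_on K (EFin \o f).
Proof.
move=> cf x Kx c; rewrite /= lte_fin => fc.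
have e0 : 0 < c - f x by rewrite subr_gt0.
have /cvgrPdist_lt/(_ _ e0) := (@subspace_continuousP _ K _ f).1 cf x Kx.
apply: (@filterS _ (within K (nbhs x))) => y; rewrite /= lte_fin distrC => H.
by have := le_lt_trans (ler_norm _) H; rewrite ltrD2r.
Qed.
End UscSum.

(** * Complex normed spaces and the unit circle *)

Section Norm.
Context {R : realType}.
(** The norm of a normed space over R[i] takes values in R[i], whose order is
    partial; [nrm] is the same norm as a real number. *)
Definition nrm {Y : normedModType R[i]} (x : Y) : R := complex.Re `|x|.
Context {Y : normedModType R[i]}.
Implicit Types x y z : Y.

Lemma nrmE x : `|x| = (nrm x)%:C.
Proof. by rewrite RRe_real // normr_real. Qed.
Lemma nrm_ge0 x : 0 <= nrm x.
Proof. by rewrite -ler0c -nrmE. Qed.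
Lemma nrmD x y : nrm (x + y) <= nrm x + nrm y.
Proof. by rewrite -lecR rmorphD /= -!nrmE ler_normD. Qed.
Lemma nrmB x y : nrm (x - y) = nrm (y - x).
Proof. by rewrite /nrm distrC. Qed.
Lemma nrm0 : nrm (0 : Y) = 0.
Proof. by rewrite /nrm normr0. Qed.
Lemma nrmZ (l : R[i]) x : nrm (l *: x) = nrm l * nrm x.
Proof.
have : (nrm (l *: x))%:C = ((nrm l)%:C * (nrm x)%:C : R[i]) by rewrite -!nrmE normrZ.
by rewrite -rmorphM => /complexI.
Qed.
Lemma nrm_triangle x y z : nrm (x - z) <= nrm (x - y) + nrm (y - z).
Proof. by apply: le_trans (nrmD _ _); rewrite addrA subrK. Qed.

Lemma nbhs_nrmP x (A : set Y) :
  nbhs x A <-> exists2 r : R, 0 < r & forall y, nrm (y - x) < r -> A y.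
Proof.
rewrite -nbhs_ballE; split=> [[r /= r0 Ar]|[r r0 Ar]].
  have rr : r \is Num.real by rewrite gtr0_real.
  exists (complex.Re r); first by rewrite -ltcR RRe_real.
  move=> y xy; apply: Ar; rewrite -ball_normE /= distrC nrmE.
  by rewrite -(RRe_real rr) ltcR.
exists r%:C; first by rewrite /= ltcR.
by move=> y; rewrite -ball_normE /= distrC nrmE ltcR; apply: Ar.
Qed.

Lemma nbhs_nrm x (r : R) : 0 < r -> \forall y \near x, nrm (y - x) < r.
Proof. by move=> r0; apply/nbhs_nrmP; exists r. Qed.
End Norm.

Section NormC.
Context {R : realType}.
Implicit Types l : R[i].
Lemma nrmR (r : R) : nrm (r%:C : R[i]) = `|r|.
Proof. by rewrite /nrm normc_def /= expr0n addr0 sqrtr_sqr. Qed.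
Lemma Re_le_nrm l : `|complex.Re l| <= nrm l.
Proof. by rewrite -lecR -nrmE normc_ge_Re. Qed.
Lemma Im_le_nrm l : `|complex.Im l| <= nrm l.
Proof. by rewrite /nrm normc_def /= -[leLHS]sqrtr_sqr ler_wsqrtr // lerDr sqr_ge0. Qed.

Definition expi (t : R) : R[i] := (cos t +i* sin t)%C.
Lemma nrm_expi t : nrm (expi t) = 1.
Proof. by rewrite /nrm normc_def /= cos2Dsin2 sqrtr1. Qed.
Lemma expiD s t : expi (s + t) = expi s * expi t.
Proof. by rewrite /expi cosD sinD; simpc; rewrite [X in _ +i* X]addrC. Qed.
Lemma expiD2pi t : expi (t + 2 * pi) = expi t.
Proof. by rewrite /expi mulr_natl cosD2pi sinD2pi. Qed.
Lemma expi0 : expi 0 = 1.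
Proof. by rewrite /expi cos0 sin0. Qed.
Lemma nrm1_expi l : nrm l = 1 -> exists2 t, 0 <= t & l = expi t.
Proof.
move=> l1; have : complex.Re l ^+ 2 + complex.Im l ^+ 2 = 1.
  have : ((complex.Re l ^+ 2 + complex.Im l ^+ 2)%:C = 1%:C)%C.
    by rewrite add_Re2_Im2 nrmE l1 expr1n.
  by move/complexI.
case: l l1 => a b _ /= ab.
have a1 : -1 <= a <= 1.
  rewrite -ler_norml -(ler_pXn2r (n := 2)) ?nnegrE // expr1n real_normK ?num_real//.
  by rewrite -ab lerDl sqr_ge0.
have sE : sin (acos a) = `|b|.
  by rewrite sin_acos // -ab addrAC subrr add0r sqrtr_sqr.
case: (leP 0 b) => b0.
  exists (acos a); first exact: acos_ge0.
  by rewrite /expi acosK ?in_itv//= sE ger0_norm.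
exists (2 * pi - acos a).
  by rewrite subr_ge0 mulr_natl mulr2n (le_trans (acos_lepi a1))// lerDl pi_ge0.
have -> : expi (2 * pi - acos a) = expi (- acos a) by rewrite addrC expiD2pi.
by rewrite /expi cosN sinN acosK ?in_itv//= sE ltr0_norm// opprK.
Qed.

End NormC.

Section NrmContinuous.
Context {R : realType} {Y : normedModType R[i]}.
Lemma ler_dist_nrm (x y : Y) : `|nrm x - nrm y| <= nrm (x - y).
Proof.
have h1 : nrm x <= nrm (x - y) + nrm y by rewrite -{1}(subrK y x) nrmD.
have h2 : nrm y <= nrm (x - y) + nrm x by rewrite -{1}(subrK x y) nrmB nrmD.
by rewrite ler_norml; apply/andP; split; lra.
Qed.
Lemma continuous_nrm : continuous (nrm : Y -> R).
Proof.
move=> x; apply/cvgrPdist_lt => e e0.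
apply: (filterS _ (nbhs_nrm x e0)) => y; rewrite nrmB; exact: le_lt_trans (ler_dist_nrm _ _).
Qed.
End NrmContinuous.

Lemma nrm_lipschitz_continuous {R : realType} {Y : normedModType R[i]} (C : R) (f : Y -> R) :
  0 < C -> (forall x y, `|f x - f y| <= C * nrm (x - y)) -> continuous f.
Proof.
move=> C0 lf x; apply/cvgrPdist_lt => e e0.
have eC : 0 < e / C by rewrite divr_gt0.
apply: (filterS _ (nbhs_nrm x eC)) => y; rewrite nrmB ltr_pdivlMr // mulrC.
exact: le_lt_trans (lf _ _).
Qed.

Lemma continuous_sqr {R : realType} {T : topologicalType} (f : T -> R) :
  continuous f -> continuous (fun x => f x ^+ 2).
Proof.
move=> cf; have -> : (fun x => f x ^+ 2) = (fun x => f x * f x) by apply/funext => x; rewrite expr2.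
by move=> x; exact: (cvgM (cf x) (cf x)).
Qed.

Section WithinCont.
Context {R : realType}.

Lemma within_near {T : topologicalType} (K : set T) (f : T -> R) x e :
  {within K, continuous f} -> K x -> 0 < e ->
  \forall y \near within K (nbhs x), `|f y - f x| < e.
Proof.
move=> cf Kx e0.
have /cvgrPdist_lt/(_ _ e0) := (@subspace_continuousP _ K _ f).1 cf x Kx.
by apply: (@filterS _ (within K (nbhs x))) => y; rewrite /= distrC.
Qed.

Lemma within_continuousD {T : topologicalType} (K : set T) (f g : T -> R) :
  {within K, continuous f} -> {within K, continuous g} ->
  {within K, continuous (fun x => f x + g x)}.
Proof. by move=> cf cg x; apply: cvgD; [exact: cf | exact: cg]. Qed.
Lemma within_continuousZ {T : topologicalType} (K : set T) (c : R) (f : T -> R) :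
  {within K, continuous f} -> {within K, continuous (fun x => c * f x)}.
Proof. by move=> cf x; apply: cvgMl_tmp; exact: cf. Qed.

Definition uniform_cont {Y : normedModType R[i]} (K : set Y) (f : Y -> R) :=
  forall e : R, 0 < e -> exists2 d : R, 0 < d &
    forall x y, K x -> K y -> nrm (x - y) < d -> `|f x - f y| < e.

Lemma compact_uniform_cont {Y : normedModType R[i]} (K : set Y) f :
  compact K -> {within K, continuous f} -> uniform_cont K f.
Proof.
move=> cK cf e e0.
apply: (@compact_ind _ K (fun S => exists2 d : R, 0 < d &
    forall x y, S x -> K y -> nrm (x - y) < d -> `|f x - f y| < e)) => //.
- by exists 1.
- by move=> A B AB [d d0 H]; exists d => // x y /AB; exact: H.
- move=> A B _ _ [d d0 H] [d' d'0 H']; exists (Num.min d d'); first by rewrite lt_min d0.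
  by move=> x y [Ax|Bx] Ky; rewrite lt_min => /andP[]; [move=> ? _; exact: H|move=> _ ?; exact: H'].
- move=> x Kx; have e2 : 0 < e / 2 by rewrite divr_gt0.
  have /nbhs_nrmP[r r0 Hr] := within_near cf Kx e2.
  have r2 : 0 < r / 2 by rewrite divr_gt0.
  exists [set y | nrm (y - x) < r / 2]; first exact: nbhs_nrm.
  exists (r / 2) => // y z [Ky /= yx] Kz yz.
  have h1 : `|f y - f x| < e / 2.
    by apply: Hr => //; rewrite (lt_le_trans yx) // ler_pdivrMr // ler_pMr // ler1n.
  have h2 : `|f z - f x| < e / 2.
    apply: Hr => //; apply: le_lt_trans (nrm_triangle _ y _) _.
    by rewrite [r]splitr ltrD // nrmB.
  rewrite (splitr e); apply: le_lt_trans (ler_distD (f x) _ _) _.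
  by rewrite ltrD // distrC.
Qed.
End WithinCont.

Section CompactClosure.
Context {R : realType}.

Lemma nrm_le_ReIm (l : R[i]) : nrm l <= `|complex.Re l| + `|complex.Im l|.
Proof.
case: l => a b /=; rewrite /nrm normc_def /=.
rewrite -(ler_pXn2r (n := 2)) ?nnegrE ?addr_ge0 ?sqrtr_ge0//.
rewrite sqr_sqrtr ?addr_ge0 ?sqr_ge0// -[a ^+ 2]real_normK ?num_real// -[b ^+ 2]real_normK ?num_real//.
have := normr_ge0 a; have := normr_ge0 b; nra.
Qed.

Lemma complex_box_compact (M : R) :
  compact [set l : R[i] | `|complex.Re l| <= M /\ `|complex.Im l| <= M].
Proof.
pose f (p : R * R) : R[i] := (p.1 +i* p.2)%C.
have cf : continuous f.
  move=> [a b] A /nbhs_nrmP[r r0 Ar].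
  have r2 : 0 < r / 2 by rewrite divr_gt0.
  exists (ball a (r / 2), ball b (r / 2)); first by split; apply: nbhsx_ballx.
  move=> [c d] [/= ac bd]; apply: Ar; apply: le_lt_trans (nrm_le_ReIm _) _ => /=.
  by rewrite (splitr r) ltrD// distrC.
have -> : [set l : R[i] | `|complex.Re l| <= M /\ `|complex.Im l| <= M] =
   f @` (`[- M, M]%classic `*` `[- M, M]%classic).
  apply/seteqP; split.
    by move=> [a b] /= [aM bM]; exists (a, b) => //; split; rewrite /= in_itv /= -ler_norml.
  by move=> _ [[a b] [/= aM bM] <-] /=; rewrite !ler_norml; move: aM bM; rewrite !in_itv /=.
apply: continuous_compact; first exact: continuous_subspaceT.
by apply: compact_setX; apply: segment_compact.
Qed.

Lemma nrm_coord n (x : 'rV[R[i]]_n) i : nrm (x ord0 i) <= nrm x.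
Proof.
rewrite -lecR -!nrmE; change (`|x ord0 i| <= mx_norm x).
by rewrite mx_normE -[leLHS]nngE num_le; exact: (le_bigmax _ _ (ord0, i)).
Qed.

Lemma closure_nrm {Y : normedModType R[i]} (D : set Y) z :
  closure D z <-> forall r : R, 0 < r -> exists2 y, D y & nrm (y - z) < r.
Proof.
split=> [Dz r r0|Dz B /nbhs_nrmP[r r0 Br]].
  by have [y [Dy zy]] := Dz _ (nbhs_nrm z r0); exists y.
by have [y Dy zy] := Dz r r0; exists y; split=> //; apply: Br.
Qed.

Lemma bounded_closure_compact n (D : set 'rV[R[i]]_n) : bounded_set D -> compact (closure D).
Proof.
move=> [M [Mreal DM]].
pose M1 := complex.Re M + 1.
have HM1 : M < M1%:C by rewrite -(RRe_real Mreal) ltcR ltrDl.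
have bnd x : closure D x -> nrm x <= M1 + 1.
  move=> /closure_nrm/(_ 1 ltr01)[y Dy yx].
  rewrite -(subrK y x); apply: le_trans (nrmD _ _) _; rewrite addrC lerD //.
    by rewrite -lecR -nrmE; apply: DM.
  by rewrite nrmB ltW.
apply: (subclosed_compact (@closed_closure _ D)
  (@rV_compact _ n (fun=> [set l : R[i] | `|complex.Re l| <= M1 + 1 /\ `|complex.Im l| <= M1 + 1]) _)).
  by move=> _; apply: complex_box_compact.
move=> x Dx i /=.
have xi : nrm (x ord0 i) <= M1 + 1 by apply: le_trans (nrm_coord _ _) (bnd _ Dx).
by split; [exact: le_trans (Re_le_nrm _) xi|exact: le_trans (Im_le_nrm _) xi].
Qed.
Lemma unit_disc_compact : compact [set l : R[i] | nrm l <= 1].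
Proof.
apply: (subclosed_compact _ (@complex_box_compact 1)).
  move=> l /closure_nrm cl /=; rewrite leNgt; apply/negP => l1.
  have l10 : 0 < nrm l - 1 by rewrite subr_gt0.
  have [y /= y1 yl] := cl _ l10.
  suff : nrm l < nrm l by rewrite ltxx.
  rewrite -{1}(subrK y l); apply: le_lt_trans (nrmD _ _) _.
  by rewrite nrmB -(subrK 1 (nrm l)) ltr_leD.
move=> l l1.
by split; [exact: le_trans (Re_le_nrm _) l1|exact: le_trans (Im_le_nrm _) l1].
Qed.

End CompactClosure.

(** * Means over an angle *)

Section IntegralMono.
Local Open Scope ereal_scope.
Import HBNNSimple.
Context d (T : measurableType d) (R : realType) (mu : {measure set T -> \bar R}).

(** Monotonicity for arbitrary functions: the integral of a nonnegative function
    is a supremum over the simple functions below it, and the conventions on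
    infinite values make the difference of the two parts monotone. Hence
    plurisubharmonic functions can be compared on circles freely. *)
Lemma integral_mono (D : set T) (f g : T -> \bar R) :
  (forall x, D x -> f x <= g x) ->
  \int[mu]_(x in D) f x <= \int[mu]_(x in D) g x.
Proof.
move=> fg.
have fgD x : (f \_ D) x <= (g \_ D) x.
  by rewrite !patchE; case: ifPn => // /set_mem /fg.
rewrite /integral; apply: leeB; apply: ereal_sup_le => _ [h /= hf <-];
  exists h => // x /=; apply: le_trans (hf x) _.
  by rewrite !funeposE ge_max !le_max lexx fgD !orbT.
by rewrite !funenegE ge_max !le_max lexx leeN2 fgD !orbT.
Qed.
End IntegralMono.

Section Mean.
Context {R : realType}.
Local Notation mu := (@lebesgue_measure R).
Local Notation circle := `[0%R, (2 * @pi R)%R]%classic.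

Lemma pi2_gt0 : 0 < 2 * pi :> R.
Proof. by rewrite mulr_gt0 ?pi_gt0. Qed.

(** Means of functions of an angle: [rmean] for the real-valued bounded
    measurable functions, on which it is linear, and [emean] for all others. *)
Definition emean (f : R -> \bar R) : \bar R :=
  (((2 * pi)^-1)%:E * \int[mu]_(t in `[0%R, (2 * pi)%R]) f t)%E.
Definition rmean (f : R -> R) : R :=
  (2 * pi)^-1 * \int[mu]_(t in `[0%R, (2 * pi)%R]) f t.

Definition bmeas (f : R -> R) := measurable_fun setT f /\ exists L, forall t, `|f t| <= L.

Lemma mu_circle : mu circle = (2 * pi)%:E.
Proof. by rewrite lebesgue_measure_itv /= lte_fin pi2_gt0 sube0. Qed.

Lemma bmeas_integrable f (A : set R) : measurable A -> (mu A < +oo)%E ->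
  bmeas f -> mu.-integrable A (EFin \o f).
Proof.
move=> mA fA [mf [L fL]]; apply: measurable_bounded_integrable => //.
  exact: measurable_funTS.
exists L; split; first exact: num_real.
by move=> M LM x _; apply: le_trans (fL x) (ltW LM).
Qed.

Lemma bmeas_int f : bmeas f -> mu.-integrable circle (EFin \o f).
Proof. by apply: bmeas_integrable => //; rewrite mu_circle ltry. Qed.

Lemma emean_EFin f : bmeas f -> emean (EFin \o f) = (rmean f)%:E.
Proof.
move=> bf; rewrite /emean /rmean /Rintegral EFinM fineK //.
exact: integrable_fin_num (bmeas_int bf).
Qed.

Lemma bmeasD f g : bmeas f -> bmeas g -> bmeas (fun t => f t + g t).
Proof.
move=> [mf [L fL]] [mg [M gM]]; split; first exact: measurable_funD.
by exists (L + M) => t; apply: le_trans (ler_normD _ _) (lerD _ _).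
Qed.
Lemma bmeas_cst c : bmeas (fun=> c).
Proof. by split; [exact: measurable_cst | exists `|c|]. Qed.
Lemma bmeasM f g : bmeas f -> bmeas g -> bmeas (fun t => f t * g t).
Proof.
move=> [mf [L fL]] [mg [M gM]]; split; first exact: measurable_funM.
by exists (L * M) => t; rewrite normrM ler_pM.
Qed.
Lemma bmeasZ c f : bmeas f -> bmeas (fun t => c * f t).
Proof. by move=> bf; apply: bmeasM => //; exact: bmeas_cst. Qed.
Lemma bmeas_sum n (f : 'I_n -> R -> R) : (forall i, bmeas (f i)) ->
  bmeas (fun t => \sum_(i < n) f i t).
Proof.
elim: n f => [|n IH] f bf.
  under [X in bmeas X]eq_fun do rewrite big_ord0; exact: bmeas_cst.
under [X in bmeas X]eq_fun do rewrite big_ord_recl; apply: bmeasD => //.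
by apply: IH.
Qed.

Lemma rmeanD f g : bmeas f -> bmeas g -> rmean (fun t => f t + g t) = rmean f + rmean g.
Proof. by move=> bf bg; rewrite /rmean -mulrDr RintegralD //; exact: bmeas_int. Qed.
Lemma rmeanZ c f : bmeas f -> rmean (fun t => c * f t) = c * rmean f.
Proof. by move=> bf; rewrite /rmean mulrCA RintegralZl //; exact: bmeas_int. Qed.
Lemma rmean_cst c : rmean (fun=> c) = c.
Proof.
rewrite /rmean Rintegral_cst // (_ : fine _ = 2 * pi).
  by rewrite mulrCA mulVf ?mulr1// gt_eqF ?pi2_gt0.
by move: mu_circle => /= ->.
Qed.
Lemma rmean_sum n (f : 'I_n -> R -> R) : (forall i, bmeas (f i)) ->
  rmean (fun t => \sum_(i < n) f i t) = \sum_(i < n) rmean (f i).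
Proof.
elim: n f => [|n IH] f bf.
  under [X in rmean X]eq_fun do rewrite big_ord0; by rewrite rmean_cst big_ord0.
under [X in rmean X]eq_fun do rewrite big_ord_recl.
rewrite rmeanD //; last by apply: bmeas_sum.
by rewrite big_ord_recl IH.
Qed.
Lemma rmean_le f g : bmeas f -> bmeas g -> (forall t, f t <= g t) -> rmean f <= rmean g.
Proof.
move=> bf bg fg; rewrite /rmean ler_pM2l ?invr_gt0 ?pi2_gt0//.
by apply: le_Rintegral => //; exact: bmeas_int.
Qed.

Lemma bmeas_continuous f L : continuous f -> (forall t, `|f t| <= L) -> bmeas f.
Proof. by move=> cf fL; split; [exact: continuous_measurable_fun | exists L]. Qed.
Lemma bmeas_cos : bmeas cos.
Proof. by apply: (@bmeas_continuous _ 1); [exact: continuous_cos | exact: cos_max]. Qed.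
Lemma bmeas_sin : bmeas sin.
Proof. by apply: (@bmeas_continuous _ 1); [exact: continuous_sin | exact: sin_max]. Qed.

Lemma rmean_cos : rmean cos = 0.
Proof.
suff: emean (EFin \o cos) = 0%:E by rewrite emean_EFin; [case|exact: bmeas_cos].
rewrite /emean (@continuous_FTC2 _ cos sin) ?pi2_gt0//.
- by rewrite mulr_natl sin2pi sin0 -EFinD subrr mule0.
- exact/continuous_subspaceT/continuous_cos.
- split=> [x _||]; first exact: ex_derive.
    exact/cvg_at_right_filter/continuous_sin.
  exact/cvg_at_left_filter/continuous_sin.
- by move=> x _; rewrite derive1E derive_val.
Qed.
Lemma rmean_sin : rmean sin = 0.
Proof.
suff: emean (EFin \o sin) = 0%:E by rewrite emean_EFin; [case|exact: bmeas_sin].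
rewrite /emean (@continuous_FTC2 _ sin (fun x => - cos x)) ?pi2_gt0//.
- by rewrite mulr_natl cos2pi cos0 -EFinD subrr mule0.
- exact/continuous_subspaceT/continuous_sin.
- split=> [x _||]; first exact: ex_derive.
    by apply/cvg_at_right_filter/continuousN; exact: continuous_cos.
  by apply/cvg_at_left_filter/continuousN; exact: continuous_cos.
- by move=> x _; rewrite derive1E derive_val opprK.
Qed.

Lemma emean_le (f g : R -> \bar R) : (forall t, (f t <= g t)%E) -> (emean f <= emean g)%E.
Proof.
move=> fg; apply: lee_wpmul2l; first by rewrite lee_fin invr_ge0 ltW ?pi2_gt0.
exact: integral_mono.
Qed.

Lemma bmeas_trig a b c : bmeas (fun t => a + (b * cos t + c * sin t)).
Proof.
apply: bmeasD; first exact: bmeas_cst.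
by apply: bmeasD; apply: bmeasZ; [exact: bmeas_cos|exact: bmeas_sin].
Qed.
Lemma rmean_trig a b c : rmean (fun t => a + (b * cos t + c * sin t)) = a.
Proof.
have := bmeas_cos; have := bmeas_sin => bs bc.
rewrite rmeanD ?rmeanD ?rmeanZ ?rmean_cst ?rmean_cos ?rmean_sin ?mulr0 ?addr0//;
  by [exact: bmeas_cst|exact: bmeasZ|apply: bmeasD; exact: bmeasZ].
Qed.

(** The squared modulus of (a + i b) + e^(i t) (p + i q), whose mean is therefore
    the sum of the squared moduli of the center and of the radius: this makes
    the squared modulus a strictly subharmonic function. *)
Lemma normsq_trigE (a b p q t : R) :
  (a + (p * cos t - q * sin t)) ^+ 2 + (b + (q * cos t + p * sin t)) ^+ 2 =
  (a ^+ 2 + b ^+ 2 + (p ^+ 2 + q ^+ 2)) +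
  ((2 * (a * p + b * q)) * cos t + (2 * (b * p - a * q)) * sin t).
Proof.
have := cos2Dsin2 t; move: (cos t) (sin t) => c s cs.
transitivity (a ^+ 2 + b ^+ 2 + (p ^+ 2 + q ^+ 2) * (c ^+ 2 + s ^+ 2) +
  (2 * (a * p + b * q) * c + 2 * (b * p - a * q) * s)); first by ring.
by rewrite cs mulr1.
Qed.

Lemma usc_measurable (f : R -> \bar R) : (forall a, open [set t | (f t < a%:E)%E]) ->
  measurable_fun setT f.
Proof.
move=> uf; have -> : f = (fun t => - (- f t))%E by apply/funext => t; rewrite oppeK.
apply: measurableT_comp => //; apply: lower_semicontinuous_measurable.
apply/lower_semicontinuousP => a.
rewrite (_ : [set x | _] = [set t | (f t < (- a)%:E)%E]) //.
by apply/seteqP; split => t /=; rewrite EFinN lteNr.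
Qed.

Lemma riemann_le (F : R -> R) (c : nat -> R) (h : R) (N : nat) : 0 <= h -> bmeas F ->
  (forall k t, (k < N)%N -> k%:R * h <= t <= k.+1%:R * h -> c k <= F t) ->
  \sum_(k < N) h * c k <= \int[mu]_(t in `[0%R, (N%:R * h)%R]) F t.
Proof.
move=> h0 bF; elim: N => [|N IH] cF.
  by rewrite big_ord0 mul0r set_itv1 Rintegral_set1.
rewrite big_ord_recr /=.
have NS : N%:R * h <= N.+1%:R * h by rewrite ler_wpM2r// ler_nat.
have itvI (a b : R) : mu.-integrable `[a, b]%classic (EFin \o F).
  apply: bmeas_integrable => //; rewrite lebesgue_measure_itv /=.
  by case: ifP => _; rewrite ?ltry // -EFinB ltry.
have E : \int[mu]_(t in `[0%R, (N.+1%:R * h)%R]) F t =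
   \int[mu]_(t in `[0%R, (N%:R * h)%R]) F t + \int[mu]_(t in `[N%:R * h, (N.+1%:R * h)%R]) F t.
  apply/eqP; rewrite addrC -subr_eq; apply/eqP.
  rewrite (@Rintegral_itvB _ F (BLeft 0) (BRight (N.+1%:R * h))) //; last first.
    by rewrite bnd_simp mulr_ge0.
  rewrite Rintegral_itv_obnd_cbnd //.
  by apply: (integrableS _ _ _ (itvI (N%:R * h) (N.+1%:R * h))) => //;
    apply: subset_itvr; rewrite bnd_simp.
rewrite E lerD//; first by apply: IH => k t kN; apply: cF; apply: ltnW.
have <- : \int[mu]_(t in `[N%:R * h, (N.+1%:R * h)%R]) c N = h * c N.
  rewrite Rintegral_cst // (_ : fine _ = h); first by rewrite mulrC.
  move: (@lebesgue_measure_itv R `[N%:R * h, N.+1%:R * h]) => /= ->; rewrite lte_fin.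
  have [lt|] := ltP (N%:R * h) (N.+1%:R * h).
    by rewrite -EFinB /= -mulrBl -natrB// subSnn mul1r.
  rewrite -{1}natr1 mulrDl mul1r gerDl => h00.
  by apply/eqP; rewrite eq_le h0 h00.
apply: le_Rintegral => //.
  apply: (@bmeas_integrable (fun=> c N)) => //; last exact: bmeas_cst.
  by rewrite lebesgue_measure_itv /=; case: ifP => _; rewrite ?ltry // -EFinB ltry.
by move=> t /=; rewrite in_itv /=; apply: cF.
Qed.

Lemma rmean_cvg (F : nat -> R -> R) (f : R -> R) (L : R) :
  (forall n, measurable_fun setT (F n)) -> (forall n t, `|F n t| <= L) ->
  (forall t, (fun n => F n t) @ \oo --> f t) ->
  (fun n => rmean (F n)) @ \oo --> rmean f.
Proof.
move=> mF FL Ff.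
have mf : measurable_fun setT f by apply: (measurable_fun_cvg mF) => t _; exact: Ff.
have fL t : `|f t| <= L.
  have : (fun n => `|F n t|) @ \oo --> `|f t| by apply: cvg_norm; exact: Ff.
  by move/cvgr_to_le; apply; apply: nearW => n; exact: FL.
have bF n : bmeas (F n) by split=> //; exists L.
have bf : bmeas f by split=> //; exists L.
have L0 : 0 <= L by apply: le_trans (fL 0).
rewrite /rmean; apply: cvgMl_tmp; rewrite /Rintegral; apply: fine_cvg.
rewrite fineK; last exact: integrable_fin_num (bmeas_int bf).
apply: (@dominated_cvg _ _ _ mu circle _ _ _ (fun=> L%:E)) => //.
- by move=> n; have /measurable_int := bmeas_int (bF n).
- by move=> t _; apply: cvg_EFin; [exact: nearW | exact: Ff].
- exact: (bmeas_int (bmeas_cst L)).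
- by move=> n t _; rewrite /= lee_fin.
Qed.

(** Comparison, by [integral_mono], with the function equal to -oo on the arc and
    to 0 elsewhere. *)
Lemma emean_ninfty (f : R -> \bar R) (a b : R) : 0 <= a -> a < b -> b <= 2 * pi ->
  (forall t, (f t <= 0)%E) -> (forall t, a < t < b -> f t = -oo%E) -> emean f = -oo%E.
Proof.
move=> a0 ab b2 f0 fab; apply/eqP; rewrite -leeNy_eq.
pose A := `]a, b[%classic.
apply: (@le_trans _ _ (emean ((cst -oo%E) \_ A))).
  apply: emean_le => t; rewrite patchE; case: ifPn => [/set_mem/= |_]; last exact: f0.
  by move=> tA; rewrite fab //; move: tA; rewrite /A /= in_itv.
rewrite /emean -integral_mkcondr (_ : _ `&` _ = A); last first.
  apply/seteqP; split => t /=; first by case.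
  rewrite /A /= !in_itv /= => /andP[h1 h2]; split; last by rewrite h1.
  by rewrite (le_trans a0 (ltW h1)) (le_trans (ltW h2)).
rewrite integral_cst //; last exact: measurable_itv.
move: (@lebesgue_measure_itv R `]a, b[) => /= ->; rewrite lte_fin ab -EFinB.
by rewrite gt0_mulNye ?lte_fin ?subr_gt0// gt0_muleNy // lte_fin invr_gt0 pi2_gt0.
Qed.

(** Nonpositive functions are reduced to nonnegative ones, for which additivity
    and monotone convergence allow infinite values. *)
Lemma emean_le0E (g : R -> \bar R) : (forall t, (g t <= 0)%E) ->
  emean g = (- (((2 * pi)^-1)%:E * \int[mu]_(t in `[0%R, (2 * pi)%R]) (- g t)))%E.
Proof.
move=> g0; rewrite -muleN -integral_ge0N; last by move=> x _; rewrite leeNr oppe0.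
by under eq_integral do rewrite oppeK.
Qed.

Lemma emeanB_cst (f : R -> \bar R) (c : R) : measurable_fun setT f -> (forall t, (f t <= 0)%E) ->
  0 <= c -> emean (fun t => f t - c%:E)%E = (emean f - c%:E)%E.
Proof.
move=> mf f0 c0.
rewrite emean_le0E; last by move=> t; rewrite leeBlDr ?add0e ?(le_trans (f0 t))// lee_fin.
rewrite (emean_le0E f0).
have Nf0 t : (0 <= - f t)%E by rewrite leeNr oppe0.
have mNf : measurable_fun circle (fun t => - f t)%E.
  by apply: measurableT_comp => //; exact: measurable_funTS.
have -> : (\int[mu]_(t in `[0%R, (2 * pi)%R]) (- (f t - c%:E)) =
    \int[mu]_(t in `[0%R, (2 * pi)%R]) (- f t + c%:E))%E.
  by apply: eq_integral => t _; rewrite fin_num_oppeB.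
have -> : (\int[mu]_(t in `[0%R, (2 * pi)%R]) (- f t + c%:E) =
    \int[mu]_(t in `[0%R, (2 * pi)%R]) (- f t) + \int[mu]_(t in `[0%R, (2 * pi)%R]) c%:E)%E.
  by apply: ge0_integralD => // t _; rewrite lee_fin.
have -> : (\int[mu]_(t in `[0%R, (2 * pi)%R]) c%:E = (c * (2 * pi))%:E)%E.
  rewrite integral_cst // EFinM; congr (_ * _)%E; exact: mu_circle.
rewrite ge0_muleDr ?integral_ge0//; last by rewrite lee_fin mulr_ge0 // ltW ?pi2_gt0.
rewrite fin_num_oppeD -?EFinM// mulrCA mulVf ?mulr1// gt_eqF ?pi2_gt0//.
Qed.

Lemma emean_dec (S : nat -> R -> R) (psi : R -> \bar R) (c : R) :
  (forall n, bmeas (S n)) -> (forall n t, S n t <= 0) ->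
  (forall n t, S n.+1 t <= S n t) ->
  (forall t, (fun n => (S n t)%:E) @ \oo --> psi t) ->
  (forall n, c <= rmean (S n)) -> (c%:E <= emean psi)%E.
Proof.
move=> bS S0 Sdec Spsi cS.
have psi0 t : (psi t <= 0)%E.
  by apply: cvge_to_le (Spsi t) _; apply: nearW => n; rewrite lee_fin.
have mS n : measurable_fun circle (fun t => (- S n t)%:E).
  apply/measurable_EFinP/measurable_funN; exact: measurable_funTS (bS n).1.
have pS n t : circle t -> (0 <= (- S n t)%:E)%E by move=> _; rewrite lee_fin oppr_ge0.
have nS t : circle t -> {homo (fun n => (- S n t)%:E) : n m / (n <= m)%N >-> (n <= m)%E}.
  move=> _; apply/nondecreasing_seqP => n; rewrite lee_fin lerN2; exact: Sdec.
have mc : measurable circle by [].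
have := @cvg_monotone_convergence _ _ _ mu circle mc _ mS pS nS.
have -> : (fun t => limn (fun n => (- S n t)%:E)) = (fun t => - psi t)%E.
  apply/funext => t; apply/cvg_lim => //.
  rewrite (_ : (fun n => _) = (fun n => - (S n t)%:E)%E) //.
  by apply: cvgeN; exact: Spsi.
move=> cv.
have : (\int[mu]_(t in circle) (- psi t) <= (- (2 * pi * c))%:E)%E.
  apply: cvge_to_le cv _; apply: nearW => n.
  have -> : (\int[mu]_(t in circle) (- S n t)%:E = (- (2 * pi * rmean (S n)))%:E)%E.
    rewrite /rmean mulrA mulfV ?mul1r ?gt_eqF ?pi2_gt0// EFinN /Rintegral fineK.
      rewrite -integralN //=; exact: integrable_add_def (bmeas_int (bS n)).
    exact: integrable_fin_num (bmeas_int (bS n)).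
  by rewrite lee_fin lerN2 ler_pM2l ?pi2_gt0.
rewrite (emean_le0E psi0) leeNr -EFinN => H.
apply: (@le_trans _ _ (((2 * pi)^-1)%:E * (- (2 * pi * c))%:E)%E).
  by apply: lee_wpmul2l H; rewrite lee_fin invr_ge0 ltW ?pi2_gt0.
by rewrite -EFinM lee_fin mulrN mulrA mulVf ?mul1r// gt_eqF ?pi2_gt0.
Qed.
End Mean.

Section Window.
Context {R : realType}.
Variables (f : R -> R) (L : R).
Hypothesis fL : forall t, `|f t| <= L.

(** The window is open, so that [window_sup d] is lower semicontinuous, hence
    measurable; it decreases to f with d when f is upper semicontinuous. It
    dominates the terms of Riemann sums of f. *)
Definition window_sup (d t : R) : R := sup [set f s | s in [set s | `|s - t| < d]].

Lemma window_has_sup d t : 0 < d -> has_sup [set f s | s in [set s | `|s - t| < d]].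
Proof.
move=> d0; split; first by exists (f t), t => //=; rewrite subrr normr0.
by exists L => _ [s _ <-]; apply: le_trans (ler_norm _) (fL s).
Qed.

Lemma window_sup_ge d t s : `|s - t| < d -> f s <= window_sup d t.
Proof.
move=> st; apply: ub_le_sup; last by exists s.
by apply: (window_has_sup t _).2; apply: le_lt_trans st.
Qed.

Lemma window_sup_le d t c : 0 < d -> (forall s, `|s - t| < d -> f s <= c) -> window_sup d t <= c.
Proof.
move=> d0 H; apply: ge_sup; first exact: (window_has_sup t d0).1.
by move=> _ [s st <-]; exact: H.
Qed.

Lemma window_sup_bmeas d : 0 < d -> bmeas (window_sup d).
Proof.
move=> d0; split; last first.
  exists L => t; rewrite ler_norml; apply/andP; split.
    apply: le_trans (window_sup_ge (s := t) _); last by rewrite subrr normr0.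
    by have := fL t; rewrite ler_norml => /andP[].
  by apply: window_sup_le => // s _; apply: le_trans (ler_norm _) (fL s).
apply/measurable_EFinP; apply: lower_semicontinuous_measurable; apply/lower_semicontinuousP => a.
rewrite openE => t /=; rewrite lte_fin => /(sup_gt (window_has_sup t d0).1)[_ [s /= st <-] as_].
have /cvgrPdist_lt := @cvg_id _ (nbhs t).
move=> /(_ (d - `|s - t|)); rewrite subr_gt0 => /(_ st).
apply: filterS => u /= tu; rewrite lte_fin; apply: lt_le_trans as_ _.
apply: window_sup_ge; rewrite -(subrK t s) -addrA.
by apply: le_lt_trans (ler_normD _ _) _; rewrite -ltrBrDl.
Qed.

Lemma window_sup_cvg (d : nat -> R) t : (forall n, 0 < d n) -> d @ \oo --> 0 ->
  usc_on setT (EFin \o f) -> (fun n => window_sup (d n) t) @ \oo --> f t.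
Proof.
move=> d0 dcv uf; apply/cvgrPdist_le => e e0.
have /nbhs_ballP[r /= r0 Hr] : nbhs t [set s | f s < f t + e].
  have := uf t I (f t + e); rewrite lte_fin ltrDl => /(_ e0).
  by apply: (@filterS _ (nbhs t)) => s /(_ I); rewrite /= lte_fin.
move/cvgrPdist_lt : dcv => /(_ _ r0); apply: filterS => k.
rewrite add0r normrN gtr0_norm // => dr.
have ge : f t <= window_sup (d k) t by apply: window_sup_ge; rewrite subrr normr0.
rewrite ler0_norm ?subr_le0// opprB lerBlDl.
apply: window_sup_le => // s st; apply/ltW/Hr; rewrite /ball /= distrC; exact: lt_trans dr.
Qed.
End Window.

(** * Plurisubharmonicity through circles *)

Section Lines.
Context {R : realType} {n : nat}.
Local Notation X := 'rV[R[i]]_n.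
Implicit Types (x a b : X) (u : X -> \bar R) (D A : set X).

Lemma nbhs_line a b (l : R[i]) A : nbhs (a + l *: b) A ->
  nbhs l [set l' | A (a + l' *: b)].
Proof.
move=> /nbhs_nrmP[r r0 Ar]; apply/nbhs_nrmP.
have b1 : 0 < nrm b + 1 by rewrite ltr_wpDl ?nrm_ge0.
exists (r / (nrm b + 1)); first by rewrite divr_gt0.
move=> l' ll' /=; apply: Ar; rewrite opprD addrACA subrr add0r -scalerBl nrmZ.
apply: le_lt_trans (_ : nrm (l' - l) * (nrm b + 1) < r).
  by rewrite ler_wpM2l ?nrm_ge0// lerDl.
by rewrite -ltr_pdivlMr.
Qed.

Lemma nbhs_expi (t : R) (A : set R[i]) : nbhs (expi t) A -> nbhs t [set s | A (expi s)].
Proof.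
move=> /nbhs_nrmP[r r0 Ar].
have r2 : 0 < r / 2 by rewrite divr_gt0.
have /cvgrPdist_lt/(_ _ r2) c := @continuous_cos R t.
have /cvgrPdist_lt/(_ _ r2) s := @continuous_sin R t.
near=> u => /=; apply: Ar; apply: le_lt_trans (nrm_le_ReIm _) _ => /=.
by rewrite (splitr r) ltrD// distrC; near: u.
Unshelve. all: by end_near. Qed.

Lemma nbhs_circle x b t A : nbhs (x + expi t *: b) A ->
  nbhs t [set s | A (x + expi s *: b)].
Proof. by move=> /nbhs_line/nbhs_expi. Qed.

Lemma usc_circle D u x b : (forall t, D (x + expi t *: b)) -> usc_on D u ->
  forall c, open [set t | (u (x + expi t *: b)%R < c%:E)%E].
Proof.
move=> Dt uu c; rewrite openE => t /= utc.
have H := uu _ (Dt t) _ utc.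
have := nbhs_circle H; rewrite /interior.
by apply: filterS => s /= /(_ (Dt s)).
Qed.

Lemma measurable_circle D u x b : (forall t, D (x + expi t *: b)) -> usc_on D u ->
  measurable_fun setT (fun t => u (x + expi t *: b)).
Proof. by move=> Dt uu; apply: usc_measurable; exact: usc_circle Dt uu. Qed.

Lemma bmeas_circle D (f : X -> R) L x b : (forall t, D (x + expi t *: b)) ->
  usc_on D (EFin \o f) -> (forall y, D y -> `|f y| <= L) ->
  bmeas (fun t => f (x + expi t *: b)).
Proof.
move=> Dt uf fL; split; last by exists L => t; exact: fL.
by apply/measurable_EFinP; exact: (measurable_circle Dt uf).
Qed.

(** The closed disc of center x and radius vector b. Letting b be any vector
    encodes at once a complex line, a radius and a choice of the origin of
    angles on the circle. *)
Definition disc_in D x b := forall l : R[i], nrm l <= 1 -> D (x + l *: b).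

Lemma disc_circle D x b : disc_in D x b -> forall t, D (x + expi t *: b).
Proof. by move=> + t; apply; rewrite nrm_expi. Qed.
Lemma disc_center D x b : disc_in D x b -> D x.
Proof. by move=> /(_ 0); rewrite nrm0 ler01 scale0r addr0; exact. Qed.

Lemma open_disc_in D x b : open D -> D x ->
  exists2 s0 : R, 0 < s0 & forall s, 0 < s -> s < s0 -> disc_in D x (s%:C *: b).
Proof.
rewrite openE => oD Dx; have /nbhs_nrmP[r r0 Dr] := oD x Dx.
have b1 : 0 < nrm b + 1 by rewrite ltr_wpDl ?nrm_ge0.
exists (r / (nrm b + 1)); first by rewrite divr_gt0.
move=> s s0 sr l l1; apply: Dr; rewrite addrAC subrr add0r !nrmZ nrmR gtr0_norm//.
apply: (@le_lt_trans _ _ (s * nrm b)).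
  by rewrite -[leRHS]mul1r ler_wpM2r // mulr_ge0 ?nrm_ge0 // ltW.
apply: (@le_lt_trans _ _ (s * (nrm b + 1))); first by rewrite ler_wpM2l ?lerDl// ltW.
by rewrite -ltr_pdivlMr.
Qed.

Lemma pshP D u : psh D u <-> [/\ usc_on D u, forall z, D z -> (u z < +oo)%E &
   forall x b, disc_in D x b -> (u x <= emean (fun t => u (x + expi t *: b)%R))%E].
Proof.
split=> [[uu ufin sub]|[uu ufin sub]]; split=> //.
  move=> x b Dxb; have [_ _ /(_ 0 1 ltr01)] := sub x b.
  rewrite scale0r addr0 => H; apply: le_trans (H _) _.
    by move=> z /=; rewrite subr0 nrmE lecR; exact: Dxb.
  by apply: emean_le => t; rewrite add0r mul1r.
move=> a b; split.
- move=> l /= Dl c ulc; exact: (nbhs_line (uu _ Dl _ ulc)).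
- by move=> l /= /ufin.
- move=> c r r0 H; have := sub (a + c *: b) (r%:C *: b).
  have -> : emean (fun t => u (a + c *: b + expi t *: (r%:C *: b))) =
    emean (fun t => u (a + (c + r%:C * expi t) *: b)).
    by congr emean; apply/funext => t; rewrite scalerDl addrA scalerA [_ * r%:C]mulrC.
  apply=> l l1; rewrite -addrA scalerA -scalerDl; apply: H => /=.
  rewrite addrAC subrr add0r normrM nrmE (nrmE r%:C) nrmR gtr0_norm// -rmorphM lecR.
  by rewrite -[leRHS]mul1r ler_wpM2r // ltW.
Qed.

End Lines.

(** * From local to global submean inequalities *)

Lemma common_threshold {R : realType} (N : nat) (P : nat -> R -> Prop) :
  (forall k, (k < N)%N -> exists2 s0, 0 < s0 & forall s, 0 < s -> s < s0 -> P k s) ->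
  exists2 s0, 0 < s0 & forall s, 0 < s -> s < s0 -> forall k, (k < N)%N -> P k s.
Proof.
elim: N => [_|N IH H]; first by exists 1.
have [s1 s10 H1] := IH (fun k kN => H k (ltnW kN)).
have [s2 s20 H2] := H N (ltnSn N).
exists (Num.min s1 s2); first by rewrite lt_min s10 s20.
move=> s s0; rewrite lt_min => /andP[ss1 ss2] k.
by rewrite ltnS leq_eqVlt => /orP[/eqP-> | kN]; [exact: H2 | exact: H1].
Qed.

(** The last step of the comparison of a Riemann sum with its integral: G is the
    sum of the N values at points of step h, and I the integral over a period T. *)
Lemma scale_riemann (R : realFieldType) (T h N G I W e : R) : 0 < T -> 0 < h ->
  N * h = T -> h * G <= I -> N * W <= G + N * e -> W <= T^-1 * I + e.
Proof.
move=> T0 h0 NhT HG HW.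
have : T * W <= I + T * e.
  apply: (@le_trans _ _ (h * G + T * e)); last by rewrite lerD2r.
  by rewrite -NhT (mulrC _ h) -!mulrA -mulrDr ler_pM2l.
by rewrite -ler_pdivlMl // mulrDr mulKf // gt_eqF.
Qed.

Section LocalToGlobal.
Context {R : realType} {n : nat}.
Local Notation X := 'rV[R[i]]_n.

Lemma sqr_nrm (l : R[i]) : nrm l ^+ 2 = complex.Re l ^+ 2 + complex.Im l ^+ 2.
Proof. by rewrite /nrm normc_def /= sqr_sqrtr // addr_ge0 ?sqr_ge0. Qed.

Lemma sqr_nrm_circle (l : R[i]) (s t : R) :
  nrm (l + expi t * s%:C) ^+ 2 = nrm l ^+ 2 + s ^+ 2 +
   ((2 * (complex.Re l * s)) * cos t + (2 * (complex.Im l * s)) * sin t).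
Proof.
rewrite !sqr_nrm; case: l => a b /=.
have := normsq_trigE a b s 0 t; rewrite !mul0r !mulr0 !subr0 !add0r !addr0 expr0n /= addr0 => <-.
by rewrite [s * _]mulrC [s * _]mulrC.
Qed.

Variables (D : set X) (W : X -> R) (L : R).
Hypothesis oD : open D.
Hypothesis uW : usc_on D (EFin \o W).
Hypothesis WL : forall x, D x -> `|W x| <= L.
Hypothesis locW : forall x b, D x -> exists2 s0, 0 < s0 &
  forall s, 0 < s -> s < s0 -> W x <= rmean (fun t => W (x + expi t *: (s%:C *: b))).

Section Disc.
Variables (x b : X) (N : nat).
Hypothesis Dxb : disc_in D x b.
Let w k := expi (k%:R * (2 * pi / N%:R) : R).
(** W averaged, up to the factor N, over the rotations of the disc by the N-th
    roots of unity. *)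
Let G (l : R[i]) := \sum_(k < N) W (x + (w k * l) *: b).

Let nrmw k l : nrm (w k * l) = nrm l.
Proof. by have := nrmZ (w k) l; rewrite nrm_expi mul1r. Qed.

Let Dw k l : nrm l <= 1 -> D (x + (w k * l) *: b).
Proof. by move=> l1; apply: Dxb; rewrite nrmw. Qed.

Let Gusc : usc_on [set l | nrm l <= 1] (EFin \o G).
Proof.
apply: usc_on_sum => k l /= l1 c Wc.
have := uW (Dw k l1) Wc.
have -> : x + (w k * l) *: b = x + l *: (w k *: b) by rewrite scalerA mulrC.
move=> /nbhs_line; apply: (@filterS _ (nbhs l)) => l' /= H l'1.
by rewrite mulrC -scalerA; apply: H; rewrite scalerA mulrC; exact: Dw.
Qed.

(** Maximum principle. Adding kappa |l|^2 makes the local submean inequality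
    strict, so that the maximum over the closed disc cannot be inside. *)
Let Gmax (kappa : R) : 0 < kappa ->
  exists2 l0, nrm l0 = 1 & G 0 <= G l0 + kappa.
Proof.
move=> k0.
pose H l := G l + kappa * nrm l ^+ 2.
have uH : usc_on [set l | nrm l <= 1] (EFin \o H).
  apply: usc_onD => //; apply: usc_on_continuous; apply: continuous_subspaceT.
  have -> : (fun l : R[i] => kappa * nrm l ^+ 2) = (fun l => kappa * (nrm l * nrm l)).
    by apply/funext => l; rewrite expr2.
  move=> l; have c := @continuous_nrm _ _ l.
  exact: (@cvgMl_tmp _ _ (nbhs l) _ _ kappa _ (cvgM c c)).
have [|l0 /= l01 Hmax] := usc_compact_max unit_disc_compact _ uH.
  by exists 0; rewrite /= nrm0.
have G0 : G 0 <= G l0 + kappa * nrm l0 ^+ 2.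
  by have := Hmax 0; rewrite /= /H nrm0 expr0n mulr0 addr0 => -> //.
have [e1|ne1] := eqVneq (nrm l0) 1.
  by exists l0 => //; move: G0; rewrite e1 expr1n mulr1.
have lt1 : nrm l0 < 1 by rewrite lt_neqAle ne1.
exfalso.
have [s0 s00 Hs0] : exists2 s0, 0 < s0 & forall s, 0 < s -> s < s0 -> forall k, (k < N)%N ->
    W (x + (w k * l0) *: b) <=
      rmean (fun t => W (x + (w k * l0) *: b + expi t *: (s%:C *: (w k *: b)))).
  apply: common_threshold => k _; apply: locW; exact: Dw.
pose s := Num.min s0 (1 - nrm l0) / 2.
have m0 : 0 < Num.min s0 (1 - nrm l0) by rewrite lt_min s00 subr_gt0.
have s_gt0 : 0 < s by rewrite divr_gt0.
have sm : s < Num.min s0 (1 - nrm l0) by rewrite ltr_pdivrMr // ltr_pMr // ltr1n.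
move: sm; rewrite lt_min => /andP[ss0 sl0].
have in1 t : nrm (l0 + expi t * s%:C) <= 1.
  apply: le_trans (nrmD _ _) _.
  have -> : nrm (expi t * s%:C) = s.
    by have := nrmZ (expi t) s%:C; rewrite nrm_expi mul1r nrmR gtr0_norm.
  by rewrite -lerBrDl ltW.
have E k t : x + (w k * l0) *: b + expi t *: (s%:C *: (w k *: b)) =
    x + (w k * (l0 + expi t * s%:C)) *: b.
  rewrite !scalerA -addrA -scalerDl; congr (_ + _ *: _); rewrite mulrDr; congr (_ + _).
  by rewrite mulrC.
have bW k : bmeas (fun t => W (x + (w k * (l0 + expi t * s%:C)) *: b)).
  under [X in bmeas X]eq_fun do rewrite -E.
  by apply: (bmeas_circle (D := D) (L := L)) => // t; rewrite E; exact: Dw.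
have GM : G l0 <= rmean (fun t => G (l0 + expi t * s%:C)).
  rewrite rmean_sum //; apply: ler_sum => k _.
  have := Hs0 s s_gt0 ss0 k (ltn_ord k).
  by under eq_fun do rewrite E.
pose trig t := (2 * (complex.Re l0 * s)) * cos t + (2 * (complex.Im l0 * s)) * sin t.
have bG : bmeas (fun t => G (l0 + expi t * s%:C)) by apply: bmeas_sum.
have : rmean (fun t => G (l0 + expi t * s%:C)) <= G l0 - kappa * s ^+ 2.
  rewrite -(rmean_trig (G l0 - kappa * s ^+ 2)
    (- kappa * (2 * (complex.Re l0 * s))) (- kappa * (2 * (complex.Im l0 * s)))).
  apply: rmean_le => //; first exact: bmeas_trig.
  move=> t; have := Hmax _ (in1 t); rewrite /H sqr_nrm_circle.
  set A := 2 * _; set B := 2 * (_ * s); lra.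
by move=> /(le_trans GM); rewrite lerDl oppr_ge0 leNgt mulr_gt0 // exprn_gt0.
Qed.


Let f (t : R) := W (x + expi t *: b).
Hypothesis N0 : (0 < N)%N.
Let h : R := 2 * pi / N%:R.
Let h_gt0 : 0 < h.
Proof. by rewrite divr_gt0 ?pi2_gt0 ?ltr0n. Qed.
Let Nh : N%:R * h = 2 * pi.
Proof. by rewrite mulrC divfK // pnatr_eq0 -lt0n. Qed.

Let Gf theta : G (expi theta) = \sum_(k < N) f (theta + k%:R * h).
Proof. by apply: eq_bigr => k _; rewrite /f [theta + _]addrC expiD. Qed.

Let fper t : f (t + 2 * pi) = f t.
Proof. by rewrite /f expiD2pi. Qed.

Let Gshift theta m :
  \sum_(k < N) f (theta + m%:R * h + k%:R * h) = \sum_(k < N) f (theta + k%:R * h).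
Proof.
elim: m => [|m <-]; first by under eq_bigr do rewrite mul0r addr0.
set tau := theta + m%:R * h.
have -> : \sum_(k < N) f (theta + m.+1%:R * h + k%:R * h) = \sum_(k < N) f (tau + k.+1%:R * h).
  by apply: eq_bigr => k _; congr f; rewrite /tau -!natr1; ring.
apply: (@addrI _ (f tau)); rewrite [RHS]addrC -[in RHS](fper tau) -Nh.
transitivity (\sum_(k < N.+1) f (tau + k%:R * h)); last by rewrite big_ord_recr.
by rewrite big_ord_recl mul0r addr0.
Qed.

(** As G is invariant under the rotations, the angle can be taken in the first of
    N equal arcs; then the k-th term of the sum is within one arc of the k-th
    arc, which is where the window of width 2 h comes from. *)
Let reduce theta : 0 <= theta -> exists theta', 0 <= theta' <= h /\
  G (expi theta) = \sum_(k < N) f (theta' + k%:R * h).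
Proof.
move=> t0; pose m := Num.truncn (theta / h).
have /Num.Theory.truncn_itv/andP[h1 h2] : 0 <= theta / h by rewrite divr_ge0 // ltW.
exists (theta - m%:R * h); split.
  rewrite subr_ge0 -ler_pdivlMr // h1 /=.
  by rewrite lerBlDr -[X in X + _]mul1r -mulrDl ltW // -ltr_pdivrMr // addrC natr1.
by rewrite -(Gshift _ m) Gf subrK.
Qed.

(** The value at the center is the rotation average at the center, at most its
    maximum over the circle, which is a Riemann sum of W on the circle. *)
Lemma disc_window_le : W x <= rmean (window_sup f (2 * h)).
Proof.
have fL t : `|f t| <= L by apply: WL; exact: disc_circle.
have h2 : 0 < 2 * h by rewrite mulr_gt0.
apply/ler_addgt0Pr => e e0.
have Ne0 : 0 < N%:R * e by rewrite mulr_gt0 ?ltr0n.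
have [l0 /nrm1_expi[theta th0 ->] G0] := Gmax Ne0.
have G0E : G 0 = N%:R * W x.
  rewrite /G; under eq_bigr do rewrite mulr0 scale0r addr0.
  by rewrite sumr_const card_ord mulr_natl.
have [th [/andP[th'0 thh] GE]] := reduce th0.
have := @riemann_le _ (window_sup f (2 * h)) (fun k => f (th + k%:R * h)) h N
  (ltW h_gt0) (window_sup_bmeas fL h2).
have H : forall (k : nat) (t : R), (k < N)%N -> k%:R * h <= t <= k.+1%:R * h ->
    f (th + k%:R * h) <= window_sup f (2 * h) t.
  move=> k t _; rewrite -natr1 => /andP[k1 k2]; apply: (window_sup_ge fL).
  by rewrite ltr_norml; apply/andP; split; nra.
move=> /(_ H); rewrite Nh -mulr_sumr -GE => H2.
have : N%:R * W x <= G (expi theta) + N%:R * e by rewrite -G0E.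
rewrite /rmean; move: (@pi2_gt0 R) Nh H2.
move: (Rintegral _ _ _) => I; move: (2 * pi) => T T0 NhT H2 H3.
exact: (scale_riemann T0 h_gt0 NhT H2 H3).
Qed.

End Disc.

(** Averaging over more and more rotations turns the maximum over the circle into
    the mean: this replaces the solution of the Dirichlet problem in the disc
    by the maximum principle for functions that are nearly radial. *)
Lemma disc_mean_le x b : disc_in D x b -> W x <= rmean (fun t => W (x + expi t *: b)).
Proof.
move=> Dxb; pose d (k : nat) : R := 2 * (2 * pi / k.+1%:R).
have d0 k : 0 < d k by rewrite mulr_gt0 // divr_gt0 ?pi2_gt0 ?ltr0n.
have fL t : `|W (x + expi t *: b)| <= L by apply: WL; exact: disc_circle.
have dcv : d @ \oo --> 0.
  have -> : d = (fun k => 2 * (2 * pi) * harmonic k).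
    by apply/funext => k; rewrite /d /harmonic mulrA.
  rewrite -[X in _ --> X](mulr0 (2 * (2 * @pi R))); apply: cvgMl_tmp; exact: cvg_harmonic.
have uf : usc_on setT (EFin \o (fun t => W (x + expi t *: b))).
  move=> t _ c Wc; have := uW (disc_circle Dxb t) Wc.
  move=> /nbhs_circle; apply: (@filterS _ (nbhs t)) => s /= H _; apply: H; exact: disc_circle.
have := @rmean_cvg _ (fun k => window_sup (fun t => W (x + expi t *: b)) (d k))
  (fun t => W (x + expi t *: b)) L.
have bw k := window_sup_bmeas fL (d0 k).
have wL k t : `|window_sup (fun t => W (x + expi t *: b)) (d k) t| <= L.
  rewrite ler_norml; apply/andP; split.
    apply: le_trans (window_sup_ge (s := t) fL _); last by rewrite subrr normr0.
    by have := fL t; rewrite ler_norml => /andP[].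
  by apply: window_sup_le => // s _; apply: le_trans (ler_norm _) (fL s).
move=> /(_ (fun k => (bw k).1) wL (fun t => window_sup_cvg fL d0 dcv uf)).
move/cvgr_to_ge; apply; apply: nearW => k.
exact: disc_window_le.
Qed.

(** Plurisubharmonicity asks for the submean inequality on every disc of D, yet a
    function obtained by gluing satisfies it a priori only on small discs. *)
Lemma psh_of_local : psh D (EFin \o W).
Proof.
apply/pshP; split=> // [z _|x b Dxb]; first exact: ltry.
rewrite [X in (_ <= emean X)%E](_ : _ = EFin \o (fun t => W (x + expi t *: b))) //.
rewrite emean_EFin ?lee_fin; first exact: disc_mean_le.
by apply: (bmeas_circle (D := D) (L := L)) => // t; exact: disc_circle.
Qed.
End LocalToGlobal.

(** * Bounded plurisubharmonic functions *)

Section BoundedPsh.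
Context {R : realType} {n : nat}.
Local Notation X := 'rV[R[i]]_n.
Implicit Types (D : set X) (f g : X -> R).

(** Real-valued and bounded, so that circular means are linear on these
    functions. *)
Definition bpsh D f := psh D (EFin \o f) /\ exists L, forall x, D x -> `|f x| <= L.

Lemma bpsh_usc D f : bpsh D f -> usc_on D (EFin \o f).
Proof. by case=> [[]]. Qed.

Lemma bpsh_bmeas D f x b : bpsh D f -> disc_in D x b -> bmeas (fun t => f (x + expi t *: b)).
Proof.
move=> [[uf _ _] [L fL]] Dxb; apply: (bmeas_circle _ uf fL); exact: disc_circle.
Qed.

Lemma bpsh_mean D f x b : bpsh D f -> disc_in D x b -> f x <= rmean (fun t => f (x + expi t *: b)).
Proof.
move=> bf Dxb; have [/pshP[uf _ mf] _] := bf.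
rewrite -lee_fin -emean_EFin; first exact: mf Dxb.
exact: bpsh_bmeas Dxb.
Qed.

Lemma bpsh_intro D f L : usc_on D (EFin \o f) -> (forall x, D x -> `|f x| <= L) ->
  (forall x b, disc_in D x b -> f x <= rmean (fun t => f (x + expi t *: b))) -> bpsh D f.
Proof.
move=> uf fL mf; split; last by exists L.
apply/pshP; split=> // [z _|x b Dxb]; first exact: ltry.
rewrite [X in (_ <= emean X)%E](_ : _ = EFin \o (fun t => f (x + expi t *: b))) //.
rewrite emean_EFin ?lee_fin; first exact: mf.
by apply: (bmeas_circle (D := D) (L := L)) => // t; exact: disc_circle.
Qed.

Lemma bpshD D f g : bpsh D f -> bpsh D g -> bpsh D (fun x => f x + g x).
Proof.
move=> bf bg; have [_ [L fL]] := bf; have [_ [M gM]] := bg.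
apply: (@bpsh_intro _ _ (L + M)).
- by apply: usc_onD; exact: bpsh_usc.
- by move=> x Dx; apply: le_trans (ler_normD _ _) (lerD (fL _ Dx) (gM _ Dx)).
- move=> x b Dxb; rewrite rmeanD; [|exact: bpsh_bmeas Dxb..].
  by apply: lerD; exact: bpsh_mean Dxb.
Qed.

Lemma usc_onZ D f c : 0 <= c -> usc_on D (EFin \o f) -> usc_on D (EFin \o (fun x => c * f x)).
Proof.
rewrite le_eqVlt => /orP[/eqP <- _|c0 uf] x Dx a /=.
  by rewrite mul0r => a0; apply: nearW => y /=; rewrite mul0r.
rewrite lte_fin -ltr_pdivlMl // => H.
have := uf x Dx (c^-1 * a); rewrite /= lte_fin => /(_ H).
by apply: (@filterS _ (within D (nbhs x))) => y /=; rewrite !lte_fin ltr_pdivlMl.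
Qed.

Lemma bpshZ D f c : 0 <= c -> bpsh D f -> bpsh D (fun x => c * f x).
Proof.
move=> c0 bf; have [_ [L fL]] := bf; apply: (@bpsh_intro _ _ (c * L)).
- by apply: usc_onZ => //; exact: bpsh_usc.
- by move=> x Dx; rewrite normrM (ger0_norm c0) ler_wpM2l // fL.
- move=> x b Dxb; rewrite rmeanZ; last exact: bpsh_bmeas Dxb.
  by rewrite ler_wpM2l //; exact: bpsh_mean Dxb.
Qed.

Lemma bpsh_cst D c : bpsh D (fun=> c).
Proof.
apply: (@bpsh_intro _ _ `|c|) => //; last by move=> x b _; rewrite rmean_cst.
by move=> x Dx a ca; exact: nearW.
Qed.

Lemma bpsh_max D f g : bpsh D f -> bpsh D g -> bpsh D (fun x => Num.max (f x) (g x)).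
Proof.
move=> bf bg; have [_ [L fL]] := bf; have [_ [M gM]] := bg.
have um : usc_on D (EFin \o (fun x => Num.max (f x) (g x))).
  move=> x Dx a /=; rewrite lte_fin gt_max => /andP[fa ga].
  have := bpsh_usc bf Dx (a := a); rewrite /= lte_fin => /(_ fa) hf.
  have := bpsh_usc bg Dx (a := a); rewrite /= lte_fin => /(_ ga) hg.
  near=> y; rewrite lte_fin gt_max -!lte_fin; apply/andP; split; near: y; [exact: hf|exact: hg].
have bm x : D x -> `|Num.max (f x) (g x)| <= L + M.
  move=> Dx; have := fL x Dx; have := gM x Dx; have := normr_ge0 (f x); have := normr_ge0 (g x).
  case: (leP (f x) (g x)) => _; lra.
apply: (@bpsh_intro _ _ (L + M)) => // x b Dxb.
have bmm : bmeas (fun t => Num.max (f (x + expi t *: b)) (g (x + expi t *: b))).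
  by apply: (bmeas_circle (D := D) (L := L + M) 
    (f := fun x => Num.max (f x) (g x))) => // t; exact: disc_circle.
rewrite ge_max; apply/andP; split.
  apply: le_trans (bpsh_mean bf Dxb) _; apply: rmean_le => //; first exact: bpsh_bmeas Dxb.
  by move=> t; rewrite le_max lexx.
apply: le_trans (bpsh_mean bg Dxb) _; apply: rmean_le => //; first exact: bpsh_bmeas Dxb.
by move=> t; rewrite le_max lexx orbT.
Unshelve. all: by end_near. Qed.

Lemma continuous_bounded (K : set X) f : compact K -> {within K, continuous f} ->
  exists L, forall x, K x -> `|f x| <= L.
Proof.
move=> cK cf; have [K0|nK] := pselect (K !=set0); last first.
  by exists 0 => x Kx; exfalso; apply: nK; exists x.
have [x Kx fx] := usc_compact_max cK K0 (usc_on_continuous cf).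
have cNf : {within K, continuous (fun x => - f x)}.
  have -> : (fun x => - f x) = (fun x => -1 * f x) by apply/funext => z; rewrite mulN1r.
  exact: within_continuousZ.
have [y Ky fy] := usc_compact_max cK K0 (usc_on_continuous cNf).
exists (Num.max `|f x| `|f y|) => z Kz; rewrite le_max.
case: (leP 0 (f z)) => fz.
  by rewrite ger0_norm // (le_trans (fx z Kz)) // ler_norm.
apply/orP; right; rewrite ltr0_norm //; apply: le_trans (fy z Kz) _.
by rewrite -normrN ler_norm.
Qed.

Lemma usc_on_sub D K (u : X -> \bar R) : D `<=` K -> usc_on K u -> usc_on D u.
Proof.
move=> DK uu x Dx a ua; have := uu x (DK _ Dx) a ua.
by apply: (@filterS _ (nbhs x)) => y H /DK.
Qed.
End BoundedPsh.

(** * Continuity of envelopes in B-regular domains *)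

Section Walsh.
Context {R : realType} {n : nat}.
Local Notation X := 'rV[R[i]]_n.
Variable (D : set X).
Hypothesis n_gt0 : (0 < n)%N.
Hypothesis D_reg : B_regular D.

Let oD : open D. Proof. by have [[]] := D_reg. Qed.
Let cD : compact (closure D). Proof. by apply: bounded_closure_compact; have [] := D_reg. Qed.
Let DcD : D `<=` closure D. Proof. exact: subset_closure. Qed.

Lemma frontier_open x : frontier D x <-> closure D x /\ ~ D x.
Proof. by rewrite /frontier (iffLR (@interior_id _ D) oD). Qed.

Let i0 : 'I_n := Ordinal n_gt0.
(** The squared modulus of one coordinate is strictly subharmonic along the axis of
    that coordinate, and one direction of strictness is enough for the maximum
    principle. *)
Let q (x : X) : R := nrm (x ord0 i0) ^+ 2.

Let q_circle x b t : q (x + expi t *: b) = (q x + q b) +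
  ((2 * (complex.Re (x ord0 i0) * complex.Re (b ord0 i0) +
         complex.Im (x ord0 i0) * complex.Im (b ord0 i0))) * cos t +
   (2 * (complex.Im (x ord0 i0) * complex.Re (b ord0 i0) -
         complex.Re (x ord0 i0) * complex.Im (b ord0 i0))) * sin t).
Proof.
rewrite /q !mxE !sqr_nrm; case: (x ord0 i0) (b ord0 i0) => a1 a2 [b1 b2] /=.
rewrite -normsq_trigE; congr (_ ^+ 2 + _ ^+ 2).
  by rewrite [cos t * _]mulrC [sin t * _]mulrC.
by rewrite [cos t * _]mulrC [sin t * _]mulrC.
Qed.

Let q_mean x b : rmean (fun t => q (x + expi t *: b)) = q x + q b.
Proof. by under eq_fun do rewrite q_circle; rewrite rmean_trig. Qed.

Let q_bmeas x b : bmeas (fun t => q (x + expi t *: b)).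
Proof. by under [X in bmeas X]eq_fun do rewrite q_circle; exact: bmeas_trig. Qed.

Let q_cont : continuous q.
Proof.
apply: continuous_sqr; apply: (nrm_lipschitz_continuous ltr01) => x y.
rewrite mul1r; apply: le_trans (ler_dist_nrm _ _) _.
by have -> : x ord0 i0 - y ord0 i0 = (x - y) ord0 i0; [rewrite !mxE | exact: nrm_coord].
Qed.

Let q_bpsh : bpsh D q.
Proof.
have qc : {within closure D, continuous q} by apply: continuous_subspaceT.
have [L qL] := continuous_bounded cD qc.
apply: (@bpsh_intro _ _ _ _ L).
- exact/(usc_on_sub DcD)/usc_on_continuous.
- by move=> x /DcD; exact: qL.
- by move=> x b _; rewrite q_mean lerDl sqr_ge0.
Qed.

Lemma psh_cont_bpsh g : {within closure D, continuous g} -> psh D (EFin \o g) -> bpsh D g.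
Proof.
move=> cg pg; split=> //; have [L gL] := continuous_bounded cD cg.
by exists L => x /DcD; exact: gL.
Qed.

(** Let h extend -q from the frontier. By strictness of q, the function h + q has
    no maximum inside D, so its maximum is its frontier value 0 and is not
    attained inside. *)
Lemma neg_exhaustion : exists rho : X -> R, [/\ {within closure D, continuous rho}, bpsh D rho,
  forall x, D x -> rho x < 0 & forall x, frontier D x -> rho x = 0].
Proof.
have [_ _ ext] := D_reg.
have [|h [ch ph hq]] := ext (fun x => - 1 * q x).
  by apply: within_continuousZ; exact: continuous_subspaceT.
have bh := psh_cont_bpsh ch ph.
pose rho x := h x + q x.
have crho : {within closure D, continuous rho}.
  by apply: within_continuousD => //; exact: continuous_subspaceT.
have nomax x : D x -> ~ (forall y, closure D y -> rho y <= rho x).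
  move=> Dx xmax.
  have [s0 s00 Hs] := open_disc_in (delta_mx ord0 i0 : X) oD Dx.
  pose s := s0 / 2.
  have s_gt0 : 0 < s by rewrite divr_gt0.
  have sl : s < s0 by rewrite ltr_pdivrMr // ltr_pMr // ltr1n.
  have Dd := Hs s s_gt0 sl; set b : X := s%:C *: delta_mx _ _ in Dd.
  have qb : q b = s ^+ 2 by rewrite /q /b !mxE !eqxx /= mulr1 nrmR gtr0_norm.
  have := bpsh_mean bh Dd.
  have : rmean (fun t => h (x + expi t *: b)) <= rmean (fun t => rho x + -1 * q (x + expi t *: b)).
    apply: rmean_le; first exact: bpsh_bmeas bh Dd.
      by apply: bmeasD; [exact: bmeas_cst | exact: bmeasZ].
    move=> t; rewrite mulN1r lerBrDr; apply: xmax; apply: DcD; exact: disc_circle.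
  rewrite rmeanD; [|exact: bmeas_cst|exact: bmeasZ].
  rewrite rmeanZ // rmean_cst q_mean qb /rho => h1 h2.
  by have := exprn_gt0 2 s_gt0; lra.
have [_ _ [d0 Dd0]] : domain D by have [] := D_reg.
have [|x0 cx0 mx0] := usc_compact_max cD _ (usc_on_continuous crho).
  by exists d0; exact: DcD.
have fr x : frontier D x -> rho x = 0.
  by move=> fx; rewrite /rho hq ?inE // mulN1r addNr.
have x00 : rho x0 = 0.
  by apply/fr/frontier_open; split=> // /nomax; exact.
exists rho; split=> //; first exact: bpshD.
move=> x Dx; rewrite ltNge; apply/negP => x0ge.
by apply: (nomax x Dx) => y cy; apply: le_trans x0ge; rewrite -x00; exact: mx0.
Qed.

(** The extension g of phi from the frontier may exceed phi inside. Since
    g - e < phi near the frontier and the negative function rho is bounded away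
    from 0 elsewhere, g - e + C rho <= phi for large C. *)
Lemma lower_barrier (phi : X -> R) (e : R) : 0 < e -> {within closure D, continuous phi} ->
  exists v : X -> R, [/\ {within closure D, continuous v}, bpsh D v,
    forall x, closure D x -> v x <= phi x & forall x, frontier D x -> v x = phi x - e].
Proof.
move=> e0 cphi; have [rho [crho brho rho_lt0 rho0]] := neg_exhaustion.
have [_ _ ext] := D_reg.
have [|g [cg pg gphi]] := ext phi.
  by apply: continuous_subspaceW cphi; exact: subIsetl.
have bg := psh_cont_bpsh cg pg.
have rho_le0 x : closure D x -> rho x <= 0.
  move=> cx; have [/rho_lt0/ltW //|nDx] := pselect (D x).
  by rewrite rho0 //; apply/frontier_open.
have [C C0 HC] : exists2 C, 0 <= C & forall x, closure D x -> g x - e + C * rho x <= phi x.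
  apply: (@compact_ind _ (closure D) (fun S => exists2 C, 0 <= C &
      forall x, S x -> g x - e + C * rho x <= phi x)) => //.
  - by exists 0.
  - by move=> A B AB [C C0 H]; exists C => // x /AB; exact: H.
  - move=> A B Ac Bc [C C0 H] [C' C'0 H']; exists (Num.max C C'); first by rewrite le_max C0.
    move=> x [Ax|Bx].
      apply: le_trans (H _ Ax); rewrite lerD2l ler_wnM2r ?le_max ?lexx //.
      by apply: rho_le0; exact: Ac.
    apply: le_trans (H' _ Bx); rewrite lerD2l ler_wnM2r ?le_max ?lexx ?orbT //.
    by apply: rho_le0; exact: Bc.
  - move=> x cx.
    have loc C : 0 <= C -> g x - e + C * rho x < phi x ->
        exists2 U, nbhs x U & exists2 C, 0 <= C &
          forall x, (closure D `&` U) x -> g x - e + C * rho x <= phi x.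
      move=> C0 lt.
      pose k y := -1 * phi y + (g y + C * rho y).
      have ck : {within closure D, continuous k}.
        apply: within_continuousD; first exact: within_continuousZ.
        by apply: within_continuousD => //; exact: within_continuousZ.
      have ke : 0 < e - k x by rewrite /k; lra.
      exists [set y | closure D y -> `|k y - k x| < e - k x]; first exact: within_near ck cx ke.
      exists C => // y [cy /= H]; have := le_lt_trans (ler_norm _) (H cy); rewrite /k; lra.
    have [Dx|nDx] := pselect (D x); last first.
      have fx : frontier D x by apply/frontier_open.
      by apply: (loc 0) => //; rewrite gphi ?inE // mul0r addr0; lra.
    have r0 := rho_lt0 x Dx.
    pose C := (`|g x - phi x|) / - rho x.
    have C0 : 0 <= C by rewrite divr_ge0 // oppr_ge0 ltW.
    apply: (loc C) => //.
    have -> : C * rho x = - `|g x - phi x| by rewrite -[rho x]opprK mulrN divfK // oppr_eq0 lt_eqF.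
    have := ler_norm (g x - phi x); lra.
exists (fun x => g x - e + C * rho x); split.
- apply: within_continuousD; last exact: within_continuousZ.
  by apply: within_continuousD => //; apply: continuous_subspaceT; exact: cst_continuous.
- apply: bpshD; last exact: bpshZ.
  by apply: bpshD => //; exact: bpsh_cst.
- by move=> x cx; exact: HC.
- by move=> x fx; rewrite gphi ?inE // rho0 // mulr0 addr0.
Qed.


(** The family of the Perron-Bremermann envelope of phi. *)
Definition psh_below (phi : X -> R) (w : X -> \bar R) :=
  psh D w /\ forall x, D x -> (w x <= (phi x)%:E)%E.

(** Walsh's translation argument. A translate of w competes with w itself after
    subtracting a small constant: near the frontier the barrier v is above the
    lowered translate, so that the maximum of the two, defined where the
    translate is, continues by v to the whole of D. *)
Lemma walsh_shift (phi : X -> R) (e : R) : 0 < e -> {within closure D, continuous phi} ->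
  exists2 d : R, 0 < d & forall w a, psh_below phi w -> nrm a < d ->
    exists2 w', psh_below phi w' & forall x, D x -> D (x + a) -> (w (x + a)%R - e%:E <= w' x)%E.
Proof.
move=> e0 cphi; pose e3 := e / 3.
have e30 : 0 < e3 by rewrite divr_gt0.
have eE : e = e3 + e3 + e3 by rewrite /e3; field.
have [v [cv bv v_le v_fr]] := lower_barrier e30 cphi.
have [d1 d10 phi_u] := compact_uniform_cont cD cphi e30.
have [d2 d20 v_u] := compact_uniform_cont cD cv e30.
pose d := Num.min d1 d2.
have d_gt0 : 0 < d by rewrite lt_min d10.
have d2_gt0 : 0 < d / 2 by rewrite divr_gt0.
have [_ [L vL]] := bv.
have [M phiM] := continuous_bounded cD cphi.
exists (d / 2) => // w a [pw wphi] ad.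
have [uw wfin mw] := (pshP D w).1 pw.
pose W x : R := if `[< D (x + a) >] then fine (maxe (v x)%:E (w (x + a)%R - e%:E)%E) else v x.
have phi_a x : D x -> D (x + a) -> phi (x + a) < phi x + e3.
  move=> /DcD Dx /DcD Dxa; have := phi_u _ _ Dxa Dx.
  rewrite addrAC subrr add0r => H.
  have da : nrm a < d1.
    apply: lt_le_trans ad _; apply: (@le_trans _ _ d); last by rewrite /d ge_min lexx.
    by rewrite ler_pdivrMr // ler_pMr // ler1n.
  by have := le_lt_trans (ler_norm _) (H da); rewrite ltrBlDl addrC.
have WE x : D x -> D (x + a) -> (W x)%:E = maxe (v x)%:E (w (x + a)%R - e%:E)%E.
  move=> Dx Dxa; rewrite /W; case: asboolP => // _; rewrite fineK //.
  have := wfin _ Dxa; case: (w (x + a)) => [r _|//|_]; first by rewrite -EFinB -EFin_max.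
  by rewrite addNye; case: leP.
have Wv x : D x -> v x <= W x.
  move=> Dx; have [Dxa|nDxa] := pselect (D (x + a)).
    by rewrite -lee_fin WE // le_max lexx.
  by rewrite /W; case: asboolP.
have Ww x : D x -> D (x + a) -> (w (x + a)%R - e%:E <= (W x)%:E)%E.
  by move=> Dx Dxa; rewrite WE // le_max lexx orbT.
have Wphi x : D x -> W x <= phi x.
  move=> Dx; have [Dxa|nDxa] := pselect (D (x + a)); last first.
    by rewrite /W; case: asboolP => // _; apply/v_le/DcD.
  rewrite -lee_fin WE // ge_max; apply/andP; split; first by rewrite lee_fin v_le //; exact: DcD.
  rewrite leeBlDr //; apply: le_trans (wphi _ Dxa) _.
  rewrite -EFinD lee_fin; have := phi_a x Dx Dxa; lra.
have Wb x : D x -> `|W x| <= `|L| + `|M|.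
  move=> Dx; have := Wv x Dx; have := Wphi x Dx; have := vL x Dx; have := phiM x (DcD Dx).
  rewrite !ler_norml => /andP[h1 h2] /andP[h3 h4] h5 h6.
  by have := ler_norm L; have := ler_norm M; have := normr_ge0 L; have := normr_ge0 M; lra.
(* If x + a is on the frontier, then v = phi - e3 there, and moving from y + a to
   x + a and then to y costs one e3 for phi and one for v. *)
have Wnear x : D x -> ~ D (x + a) -> \forall y \near within D (nbhs x), W y = v y.
  move=> Dx nDxa.
  have [cxa|ncxa] := pselect (closure D (x + a)); last first.
    have : nbhs (x + a) (~` closure D).
      by apply: open_nbhs_nbhs; split => //; apply: closed_openC; exact: closed_closure.
    move=> /nbhs_nrmP[r r0 Hr]; apply: (filterS _ (nbhs_nrm x r0)) => y yx Dy.
    rewrite /W; case: asboolP => // Dya; exfalso.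
    by apply: (Hr (y + a)); [rewrite opprD addrACA subrr addr0 | exact: DcD].
  have fxa : frontier D (x + a) by apply/frontier_open.
  apply: (filterS _ (nbhs_nrm x d2_gt0)) => y yx Dy.
  have [Dya|nDya] := pselect (D (y + a)); last by rewrite /W; case: asboolP.
  suff [] : (W y)%:E = (v y)%:E by [].
  rewrite WE //; apply/max_idPl; rewrite leeBlDr //; apply: le_trans (wphi _ Dya) _.
  rewrite -EFinD lee_fin.
  have h1 : phi (y + a) < phi (x + a) + e3.
    have := phi_u _ _ (DcD Dya) cxa; rewrite opprD addrACA subrr addr0 => H.
    have yd : nrm (y - x) < d1.
      apply: lt_le_trans yx _; apply: (@le_trans _ _ d); last by rewrite /d ge_min lexx.
      by rewrite ler_pdivrMr // ler_pMr // ler1n.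
    by have := le_lt_trans (ler_norm _) (H yd); rewrite ltrBlDl addrC.
  have h2 : v (x + a) < v y + e3.
    have dd : nrm (x + a - y) < d2.
      rewrite addrAC; apply: le_lt_trans (nrmD _ _) _; rewrite nrmB.
      apply: (@lt_le_trans _ _ d); last by rewrite /d ge_min lexx orbT.
      by rewrite (splitr d) ltrD.
    by have := le_lt_trans (ler_norm _) (v_u _ _ cxa (DcD Dy) dd); rewrite ltrBlDl addrC.
  by have := v_fr _ fxa; lra.
have uv := bpsh_usc bv.
have uW : usc_on D (EFin \o W).
  move=> x Dx c; have [Dxa|nDxa] := pselect (D (x + a)); last first.
    rewrite /= {1}/W; case: asboolP => // _ vc.
    have h := uv x Dx c vc; near=> y.
    have -> : W y = v y by near: y; exact: Wnear.
    near: y; exact: h.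
  rewrite /= WE // gt_max => /andP[vc wc].
  have hv := uv x Dx c vc.
  have wc' : (w (x + a)%R < (c + e)%:E)%E by rewrite EFinD -lteBlDr.
  have /nbhs_nrmP[r r0 hw] := uw _ Dxa _ wc'.
  have /nbhs_nrmP[r' r'0 hD] : nbhs (x + a) D by apply: open_nbhs_nbhs.
  have hr := @nbhs_nrm _ _ x _ r0; have hr' := @nbhs_nrm _ _ x _ r'0.
  have shift y : y + a - (x + a) = y - x by rewrite opprD addrACA subrr addr0.
  have Dya : \forall y \near within D (nbhs x), D (y + a).
    by apply: (filterS _ hr') => y yx _; apply: hD; rewrite shift.
  have wya : \forall y \near within D (nbhs x), D (y + a) -> (w (y + a)%R < (c + e)%:E)%E.
    by apply: (filterS _ hr) => y yx _; apply: hw; rewrite shift.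
  have Dy : \forall y \near within D (nbhs x), D y.
    by apply: (@filterE _ (nbhs x)) => y.
  near=> y; rewrite /=.
  have Dy' : D y by near: y; exact: Dy.
  have Dya' : D (y + a) by near: y; exact: Dya.
  have wy : D (y + a) -> (w (y + a)%R < (c + e)%:E)%E by near: y; exact: wya.
  have vy : ((v y)%:E < c%:E)%E by near: y; exact: hv.
  by rewrite WE // gt_max vy andTb lteBlDr // -EFinD wy.
have mW x b : D x -> exists2 s0, 0 < s0 &
    forall s, 0 < s -> s < s0 -> W x <= rmean (fun t => W (x + expi t *: (s%:C *: b))).
  move=> Dx; have [s1 s10 H1] := open_disc_in b oD Dx.
  have bW s : 0 < s -> s < s1 -> bmeas (fun t => W (x + expi t *: (s%:C *: b))).
    move=> s0 ss; apply: (bmeas_circle (D := D) (L := `|L| + `|M|)) => // t.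
    by apply: disc_circle; exact: H1.
  have vW s : 0 < s -> s < s1 -> v x <= rmean (fun t => W (x + expi t *: (s%:C *: b))).
    move=> s0 ss; apply: le_trans (bpsh_mean bv (H1 s s0 ss)) _.
    apply: rmean_le; [exact: bpsh_bmeas bv (H1 s s0 ss)|exact: bW|].
    by move=> t; apply: Wv; apply: disc_circle; exact: H1.
  have [Dxa|nDxa] := pselect (D (x + a)); last first.
    by exists s1 => // s s0 ss; rewrite {1}/W; case: asboolP => // _; exact: vW.
  have [s2 s20 H2] := open_disc_in b oD Dxa.
  exists (Num.min s1 s2); first by rewrite lt_min s10.
  move=> s s0; rewrite lt_min => /andP[ss1 ss2].
  rewrite -lee_fin WE // ge_max; apply/andP; split; first by rewrite lee_fin vW.
  rewrite leeBlDr //.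
  apply: le_trans (mw _ _ (H2 s s0 ss2)) _.
  apply: (@le_trans _ _ (emean (EFin \o (fun t => W (x + expi t *: (s%:C *: b)) + e)))).
    apply: emean_le => t; rewrite -addrA [a + _]addrC addrA /= EFinD -leeBlDr //.
    apply: Ww; first by apply: disc_circle; exact: H1.
    by rewrite addrAC; apply: disc_circle; exact: H2.
  have bWs := bW s s0 ss1.
  rewrite emean_EFin; last by apply: bmeasD => //; exact: bmeas_cst.
  by rewrite rmeanD ?rmean_cst //; exact: bmeas_cst.
exists (EFin \o W) => //; split.
  by apply: (@psh_of_local _ _ D W (`|L| + `|M|)) => // x b; exact: mW.
by move=> x Dx; rewrite /= lee_fin Wphi.
Unshelve. all: by end_near. Qed.

(** Translation invariance of the family, up to a constant, makes its supremum
    uniformly continuous. The supremum is thus upper semicontinuous, and it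
    inherits the submean inequality of the members of the family. *)
Lemma walsh_envelope (phi : X -> R) (m : R) : {within closure D, continuous phi} ->
  (forall x, D x -> m <= phi x) ->
  exists V : X -> R, [/\ psh D (EFin \o V), uniform_cont D V,
    forall x, D x -> m <= V x <= phi x &
    forall w x, psh_below phi w -> D x -> (w x <= (V x)%:E)%E].
Proof.
move=> cphi mphi.
pose Ve x := ereal_sup [set w x | w in psh_below phi].
pose V x := fine (Ve x).
have wV w x : psh_below phi w -> (w x <= Ve x)%E.
  by move=> pw; apply: ereal_sup_ubound; exists w.
have mV x : D x -> (m%:E <= Ve x)%E.
  move=> Dx; apply: (@wV (EFin \o (fun=> m))); split; first by case: (bpsh_cst D m).
  by move=> y Dy; rewrite /= lee_fin mphi.
have Vphi x : D x -> (Ve x <= (phi x)%:E)%E.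
  by move=> Dx; apply: ge_ereal_sup => _ [w [_ wphi] <-]; exact: wphi.
have VE x : D x -> (V x)%:E = Ve x.
  move=> Dx; rewrite fineK // fin_numElt.
  by rewrite (lt_le_trans _ (mV x Dx)) ?ltNyr // (le_lt_trans (Vphi x Dx)) ?ltry.
have shiftV e : 0 < e -> exists2 d : R, 0 < d &
    forall x y, D x -> D y -> nrm (x - y) < d -> V x - e <= V y.
  move=> e0; have [d d0 H] := walsh_shift e0 cphi.
  exists d => // x y Dx Dy xy; rewrite -lee_fin EFinB leeBlDr // !VE //.
  apply: ge_ereal_sup => _ [w pw <-].
  have [w' pw' ww'] := H w (x - y) pw xy.
  have yx : y + (x - y) = x by rewrite addrC subrK.
  have := ww' y Dy; rewrite yx => /(_ Dx); rewrite leeBlDr // => h.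
  by apply: le_trans h _; rewrite leeD2r // wV.
have uV : uniform_cont D V.
  move=> e e0; have e2 : 0 < e / 2 by rewrite divr_gt0.
  have [d d0 H] := shiftV _ e2; exists d => // x y Dx Dy xy.
  have h1 := H x y Dx Dy xy; have := H y x Dy Dx; rewrite nrmB => /(_ xy) h2.
  have : e = e / 2 + e / 2 by rewrite -splitr.
  by rewrite ltr_norml => ee; apply/andP; split; lra.
have bV x : D x -> m <= V x <= phi x.
  by move=> Dx; rewrite -!lee_fin VE // mV // Vphi.
exists V; split=> //; last by move=> w x pw Dx; rewrite VE // wV.
apply/pshP; split=> [x Dx c|z _|x b Dxb]; last 1 first.
- rewrite /= VE; last exact: disc_center Dxb.
  apply: ge_ereal_sup => _ [w pw <-]; have [/pshP[_ _ mw] _] := pw.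
  apply: le_trans (mw x b Dxb) _; apply: emean_le => t.
  by rewrite VE ?wV //; exact: disc_circle.
- rewrite /= lte_fin => Vc; have c0 : 0 < c - V x by rewrite subr_gt0.
  have [d d0 H] := uV _ c0.
  apply: (filterS _ (nbhs_nrm x d0)) => y yx Dy; rewrite /= lte_fin.
  by have := le_lt_trans (ler_norm _) (H y x Dy Dx yx); rewrite ltrD2r.
- exact: ltry.
Qed.
End Walsh.

(** * Upper limits and the set where the value is -oo *)

Section UscExt.
Context {R : realType} {Y : normedModType R[i]}.
Implicit Types (D : set Y) (u : Y -> \bar R).

Lemma usc_ext_lt D u z c : (usc_ext D u z < c)%E -> \forall y \near within D (nbhs z), (u y < c)%E.
Proof.
move=> /ereal_inf_lt[_ [V VD <-] Vc].
apply: (filterS _ VD) => y Vy /=; apply: le_lt_trans Vc.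
by apply: ereal_sup_ubound; exists y.
Qed.

Lemma usc_ext_le D u z c : (\forall y \near within D (nbhs z), (u y <= c)%E) ->
  (usc_ext D u z <= c)%E.
Proof.
move=> H; apply: ge_ereal_inf; exists (ereal_sup (u @` [set y | (u y <= c)%E])).
  by exists [set y | (u y <= c)%E].
by apply: ge_ereal_sup => _ [y /= yc <-].
Qed.

Lemma usc_ext_ge D u z : D z -> (u z <= usc_ext D u z)%E.
Proof.
move=> Dz; apply: le_ereal_inf_tmp => _ [V VD <-].
by apply: ereal_sup_ubound; exists z => //; exact: (nbhs_singleton VD).
Qed.

Lemma usc_ext_gtP D u z (c : R) : (c%:E < usc_ext D u z)%E ->
  forall r : R, 0 < r -> exists2 y, D y & nrm (y - z) < r /\ (c%:E < u y)%E.
Proof.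
move=> cz r r0; apply: contrapT => H; move: cz; rewrite ltNge => /negP; apply.
apply: usc_ext_le; apply: (filterS _ (nbhs_nrm z r0)) => y yz Dy.
by rewrite leNgt; apply/negP => cu; apply: H; exists y.
Qed.
End UscExt.

Section Ninfty.
Context {R : realType} {n : nat}.
Local Notation X := 'rV[R[i]]_n.
Variables (D : set X) (u : X -> \bar R).
Hypothesis dD : domain D.
Hypothesis pu : psh D u.
Hypothesis u0 : forall x, D x -> (u x <= 0)%E.

(** The interior of the -oo set is closed in D: a point x near a point s of this
    interior is the center of a circle through s, an arc of which lies in the
    -oo set. Connectedness does the rest. *)
Lemma psh_ninfty_nbhs q : D q -> (\forall y \near q, u y = -oo%E) ->
  forall x, D x -> u x = -oo%E.
Proof.
move=> Dq qn; have [oD conD _] := dD; have /pshP[_ _ mu] := pu.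
pose N : set X := [set x | \forall y \near x, u y = -oo%E].
have BD : D `&` N = D.
  apply: conD; first by exists q.
    by exists N => //; rewrite openE => x; exact: nbhs_interior.
  exists (closure (D `&` N)); first exact: closed_closure.
  apply/seteqP; split => [x [Dx Nx]|p [Dp /closure_nrm cp]].
    by split => //; exact: subset_closure.
  split; first exact: Dp.
  have /nbhs_nrmP[rho rho0 Hrho] : nbhs p D by exact: open_nbhs_nbhs.
  (* Both x and s are within rho / 4 of p, so the disc centered at x whose circle
     passes through s stays within 3 rho / 4 of p. *)
  have r0 : 0 < rho / 4 by rewrite divr_gt0.
  have rE : rho = rho / 4 + (rho / 4 + rho / 4) + rho / 4 by field.
  have [s [Ds Ns] sp] := cp _ r0.
  apply: (filterS _ (nbhs_nrm p r0)) => x xp.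
  have bx : nrm (s - x) < rho / 4 + rho / 4.
    by apply: le_lt_trans (nrm_triangle _ p _) _; rewrite ltrD // nrmB.
  have Dxb : disc_in D x (s - x).
    move=> l l1; apply: Hrho; rewrite addrAC; apply: le_lt_trans (nrmD _ _) _.
    have : nrm (l *: (s - x)) <= nrm (s - x).
      by rewrite nrmZ -[leRHS]mul1r ler_wpM2r // nrm_ge0.
    lra.
  have := mu x (s - x) Dxb.
  have : nbhs (x + expi 0 *: (s - x)) [set y | u y = -oo%E].
    by rewrite expi0 scale1r addrC subrK.
  move=> /nbhs_circle/nbhs_ballP[d /= d0 Hd].
  rewrite (@emean_ninfty _ _ 0 (Num.min d (2 * pi))) //.
  - by rewrite leeNy_eq => /eqP.
  - by rewrite lt_min d0 pi2_gt0.
  - by rewrite ge_min lexx orbT.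
  - by move=> t; apply: u0; exact: disc_circle.
  - move=> t; rewrite lt_min => /andP[t0 /andP[td _]]; apply: Hd.
    by rewrite /ball /= sub0r normrN gtr0_norm.
move=> x Dx; move: (Dx); rewrite -BD => -[_]; exact: nbhs_singleton.
Qed.

Lemma psh_sub1 : psh D (fun x => u x - 1)%E.
Proof.
have /pshP[uu ufin mu] := pu; apply/pshP; split.
- move=> x Dx c; rewrite lteBlDr // -EFinD => uc.
  apply: (@filterS _ (within D (nbhs x)) _ _ _ _ (uu x Dx _ uc)) => y.
  by rewrite lteBlDr // -EFinD.
- by move=> z Dz; rewrite lteBlDr //= ufin.
- move=> x b Dxb; rewrite (@emeanB_cst _ (fun t => u (x + expi t *: b)) 1) //.
  + by rewrite leeB //; exact: mu.
  + by apply: (measurable_circle _ uu); exact: disc_circle.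
  + by move=> t; apply: u0; exact: disc_circle.
Qed.
End Ninfty.

(** * Separating a compact set from a point *)

Section Separation.
Context {R : realType} {n : nat}.
Local Notation X := 'rV[R[i]]_n.
Implicit Types (D F K T P : set X) (u : X -> \bar R) (v : X -> R).

(** The minimum of finitely many downward bumps of depth 1, each supported in a
    ball on which u < - T. *)
Lemma continuous_majorant D F u (T : R) : compact F -> 0 < T -> (forall x, D x -> (u x < 0)%E) ->
  (forall x, F x -> usc_ext D u x = -oo%E) ->
  exists phi : X -> R, [/\ continuous phi, forall x, -1 <= phi x <= 0,
    forall x, F x -> phi x < - 2^-1 & forall x, D x -> (u x <= (T * phi x)%:E)%E].
Proof.
move=> cF T0 u0 uF.
apply: (@compact_ind _ F (fun S => exists phi : X -> R, [/\ continuous phi,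
    forall x, -1 <= phi x <= 0, forall x, S x -> phi x < - 2^-1 &
    forall x, D x -> (u x <= (T * phi x)%:E)%E])) => //.
- exists (fun=> 0); split=> //; first exact: cst_continuous.
    by move=> _; rewrite lexx lerN10.
  by move=> x Dx; rewrite mulr0 ltW // u0.
- by move=> A B AB [phi [h1 h2 h3 h4]]; exists phi; split=> // x /AB; exact: h3.
- move=> A B _ _ [f [f1 f2 f3 f4]] [g [g1 g2 g3 g4]].
  exists (fun x => Num.min (f x) (g x)); split.
  + by move=> x; exact: (@continuous_min _ _ f g x (f1 x) (g1 x)).
  + by move=> x; have := f2 x; have := g2 x; case: (leP (f x) (g x)).
  + by move=> x [Ax|Bx]; rewrite gt_min; apply/orP; [left; exact: f3|right; exact: g3].
  + by move=> x Dx; case: (leP (f x) (g x)) => _; [exact: f4|exact: g4].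
- move=> z Fz.
  have : (usc_ext D u z < (- T)%:E)%E by rewrite uF // ltNyr.
  move=> /usc_ext_lt/nbhs_nrmP[r r0 Hr].
  have r2 : 0 < r / 2 by rewrite divr_gt0.
  exists [set y | nrm (y - z) < r / 2]; first exact: (nbhs_nrm z r2).
  pose g (x : X) : R := - Num.max 0 (1 - r^-1 * nrm (x - z)).
  have g01 x : -1 <= g x <= 0.
    have : 0 <= r^-1 * nrm (x - z) by rewrite mulr_ge0 ?nrm_ge0 // invr_ge0 ltW.
    by rewrite /g; case: (leP 0 (1 - r^-1 * nrm (x - z))) => h h'; apply/andP; split; lra.
  exists g; split=> //.
  + have ri0 : 0 < r^-1 by rewrite invr_gt0.
    apply: (nrm_lipschitz_continuous ri0) => x y.
    have h : `|nrm (x - z) - nrm (y - z)| <= nrm (x - y).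
      by apply: le_trans (ler_dist_nrm _ _) _; rewrite opprB addrA subrK.
    have : `|r^-1 * nrm (x - z) - r^-1 * nrm (y - z)| <= r^-1 * nrm (x - y).
      by rewrite -mulrBr normrM gtr0_norm // ler_pM2l.
    rewrite /g !ler_norml => /andP[h1 h2].
    case: (leP 0 (1 - r^-1 * nrm (x - z))) => hx; case: (leP 0 (1 - r^-1 * nrm (y - z))) => hy;
      by apply/andP; split; lra.
  + move=> x [_ /= xz]; rewrite /g ltrN2 lt_max; apply/orP; right.
    have : r^-1 * nrm (x - z) < 2^-1 by rewrite ltr_pdivrMl.
    lra.
  + move=> x Dx; case: (ltP (nrm (x - z)) r) => xz.
      apply: le_trans (ltW (Hr _ xz Dx)) _; rewrite lee_fin.
      by have /andP[h _] := g01 x; rewrite -[- T]mulrN1 ler_wpM2l // ltW.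
    rewrite /g max_l ?oppr0 ?mulr0; first by rewrite ltW // u0.
    by rewrite subr_le0 ler_pdivlMl // mulr1.
Qed.

(** The building blocks of the final series: a definite negative contribution
    near F, and values in [-1, 0] on D. The condition at a frontier point is on
    the values in D near that point, which are all that the upper limits there
    depend on. *)
Definition separator D F v := [/\ psh D (EFin \o v), uniform_cont D v,
  forall x, D x -> -1 <= v x <= 0 &
  forall z, F z -> \forall y \near within D (nbhs z), v y < - 2^-1].

Definition above D (e : R) v (p : X) := \forall y \near within D (nbhs p), - e < v y.

Lemma separator_max D F v w : separator D F v -> separator D F w ->
  separator D F (fun x => Num.max (v x) (w x)).
Proof.
move=> [pv cv v01 vF] [pw cw w01 wF]; split.
- have b f : psh D (EFin \o f) -> (forall x, D x -> -1 <= f x <= 0) -> bpsh D f.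
    move=> pf f01; split => //; exists 1 => x /f01 /andP[h1 h2].
    by rewrite ler_norml h1 (le_trans h2).
  by have [] := bpsh_max (b _ pv v01) (b _ pw w01).
- move=> e e0; have [d d0 hd] := cv e e0; have [d' d'0 hd'] := cw e e0.
  exists (Num.min d d'); first by rewrite lt_min d0.
  move=> x y Dx Dy; rewrite lt_min => /andP[xy xy'].
  have := hd x y Dx Dy xy; have := hd' x y Dx Dy xy'.
  rewrite !ltr_norml => /andP[h1 h2] /andP[h3 h4].
  by case: (leP (v x) (w x)) => h; case: (leP (v y) (w y)) => h'; apply/andP; split; lra.
- by move=> x Dx; have := v01 x Dx; have := w01 x Dx; case: (leP (v x) (w x)).
- move=> z Fz; have h := vF z Fz; have h' := wF z Fz.
  near=> y; rewrite gt_max; apply/andP; split; near: y; [exact: h|exact: h'].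
Unshelve. all: by end_near. Qed.

Lemma above_maxl D e v w p : above D e v p -> above D e (fun x => Num.max (v x) (w x)) p.
Proof. by apply: (@filterS _ (within D (nbhs p))) => y vy; rewrite lt_max vy. Qed.
Lemma above_maxr D e v w p : above D e w p -> above D e (fun x => Num.max (v x) (w x)) p.
Proof. by apply: (@filterS _ (within D (nbhs p))) => y vy; rewrite lt_max vy orbT. Qed.

Lemma separator_cst D F : separator D F (fun=> -1).
Proof.
split; first by case: (bpsh_cst D (-1)).
- by move=> e e0; exists 1 => // x y _ _ _; rewrite subrr normr0.
- by move=> x _; rewrite lexx lerN10.
- by move=> z _; apply: nearW => y; rewrite ltrN2 invf_lt1 // ltr1n.
Qed.

(** Scaling u down would bring its value at p close to 0; scaling the continuous
    majorant up by T has the same effect and keeps u unchanged. The envelope of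
    T phi stays above u, hence above - T e near points of D close to p, and its
    continuity spreads the bound to a neighborhood of p. *)
Lemma separate_point D F u p (e : R) : (0 < n)%N -> B_regular D -> compact F ->
  psh D u -> (forall x, D x -> (u x < 0)%E) ->
  (forall z, F z -> usc_ext D u z = -oo%E) -> usc_ext D u p <> -oo%E -> 0 < e ->
  exists2 v, separator D F v & above D e v p.
Proof.
move=> n0 Dreg cF pu u0 uF up e0.
have [c cp] : exists c : R, (c%:E < usc_ext D u p)%E.
  case: (usc_ext D u p) up => [r _||//]; last by exists 0; rewrite ltry.
  by exists (r - 1); rewrite lte_fin ltrBlDr ltrDl.
(* V exceeds c at points close to p and varies by less than |c| + 1 around them,
   so it exceeds - 2 (|c| + 1) = - T e near p. *)
pose T := (`|c| + 1) * 2 / e.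
have T0 : 0 < T by rewrite divr_gt0 // mulr_gt0 // ltr_wpDl.
have TeE : T * e = (`|c| + 1) * 2 by rewrite /T divfK // gt_eqF.
have [phi [cphi phi01 phiF phiu]] := continuous_majorant cF T0 u0 uF.
have [||V [pV cV bV uV]] := @walsh_envelope _ _ D n0 Dreg (fun x => T * phi x) (- T).
- by apply: within_continuousZ; exact: continuous_subspaceT.
- by move=> x _; have /andP[h _] := phi01 x; rewrite -[- T]mulrN1 ler_wpM2l // ltW.
have bpV : bpsh D V.
  split => //; exists T => x /bV /andP[h1 h2]; rewrite ler_norml h1 (le_trans h2) //.
  have /andP[_ h] := phi01 x; apply: (@le_trans _ _ 0); last exact: ltW.
  by rewrite pmulr_rle0.
exists (fun x => T^-1 * V x).
  split.
  - by have [] := bpshZ (ltW (_ : 0 < T^-1)) bpV; rewrite ?invr_gt0.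
  - move=> d d0; have Td : 0 < T * d by rewrite mulr_gt0.
    have [d' d'0 H] := cV _ Td; exists d' => // x y Dx Dy xy.
    rewrite -mulrBr normrM gtr0_norm ?invr_gt0 // ltr_pdivrMl //; exact: H.
  - move=> x Dx; have /andP[h1 h2] := bV x Dx.
    rewrite ler_pdivlMl // mulrN1 h1 ler_pdivrMl // mulr0 (le_trans h2) //.
    by have /andP[_ h] := phi01 x; rewrite pmulr_rle0.
  - move=> z Fz.
    have lt := phiF z Fz.
    have /cvgrPdist_lt/(_ (- 2^-1 - phi z)) := cphi z.
    rewrite subr_gt0 => /(_ lt); apply: (@filterS _ (nbhs z)) => y /= yz Dy.
    have /andP[_ h2] := bV y Dy.
    apply: (@le_lt_trans _ _ (phi y)); first by rewrite ler_pdivrMl.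
    by move: yz; rewrite distrC => /(le_lt_trans (ler_norm _)); rewrite ltrD2r.
have Te2 : 0 < `|c| + 1 by rewrite ltr_wpDl.
have [d d0 Hd] := cV _ Te2.
have d2 : 0 < d / 2 by rewrite divr_gt0.
have [x Dx [xp cux]] := usc_ext_gtP cp d2.
apply: (filterS _ (nbhs_nrm p d2)) => y yp Dy.
have xy : nrm (x - y) < d.
  apply: le_lt_trans (nrm_triangle _ p _) _; rewrite (splitr d) ltrD //.
  by rewrite nrmB.
have h1 : c < V x.
  rewrite -lte_fin; apply: lt_le_trans cux _; apply: uV => //; split => //.
have h2 := le_lt_trans (ler_norm _) (Hd _ _ Dx Dy xy).
rewrite ltr_pdivlMl // mulrN TeE.
have := ler_norm (- c); rewrite normrN; lra.
Qed.

End Separation.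

(** * Sets outside the hull *)

Section Cumul.
Context {T : Type}.
Definition cumul (B : nat -> set T) m : set T := [set x | exists2 i, (i <= m)%N & B i x].

Lemma cumul0 B : cumul B 0 = B 0%N.
Proof.
apply/seteqP; split => [x [k]|x Bx]; last by exists 0%N.
by rewrite leqn0 => /eqP ->.
Qed.
Lemma cumulS B m : cumul B m.+1 = cumul B m `|` B m.+1.
Proof.
apply/seteqP; split => [x [k]|x [[i im Bx]|Bx]].
- by rewrite leq_eqVlt => /orP[/eqP -> ? | im Bx]; [right | left; exists k].
- by exists i => //; exact: leqW.
- by exists m.+1.
Qed.
Lemma cumul_mono B i j : (i <= j)%N -> cumul B i `<=` cumul B j.
Proof. by move=> ij x [k ki Bx]; exists k => //; exact: leq_trans ij. Qed.
End Cumul.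

Lemma compact_cumul {T : topologicalType} (B : nat -> set T) m :
  (forall i, compact (B i)) -> compact (cumul B m).
Proof.
by move=> cB; elim: m => [|m IH]; rewrite ?cumul0 // cumulS; exact: compactU.
Qed.

Section Tame.
Context {R : realType} {n : nat}.
Local Notation X := 'rV[R[i]]_n.
Variables (D A : set X).
Hypothesis n_gt0 : (0 < n)%N.
Hypothesis D_reg : B_regular D.
Hypothesis A_pp : b_pluripolar D A.
Local Notation H := (b_pluripolar_hull D A).

Let dD : domain D. Proof. by have [] := D_reg. Qed.
Let oD : open D. Proof. by have [] := dD. Qed.
Let cD : compact (closure D). Proof. by apply: bounded_closure_compact; have [] := D_reg. Qed.

(** Sets that separators can keep close to 0, whatever compact part of the hull
    they are to be negative on. *)
Definition tame (T : set X) := forall (e : R) F, 0 < e -> compact F -> F `<=` H ->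
  exists2 v, separator D F v & forall p, T p -> above D e v p.

Lemma tame0 : tame set0.
Proof. by move=> e F _ _ _; exists (fun=> -1) => //; exact: separator_cst. Qed.

Lemma tameU S T : tame S -> tame T -> tame (S `|` T).
Proof.
move=> tS tT e F e0 cF FH; have [v sv vS] := tS e F e0 cF FH; have [w sw wT] := tT e F e0 cF FH.
exists (fun x => Num.max (v x) (w x)); first exact: separator_max.
by move=> p [/vS|/wT]; [exact: above_maxl|exact: above_maxr].
Qed.

Lemma tame_cumul B m : (forall i, tame (B i)) -> tame (cumul B m).
Proof. by move=> tB; elim: m => [|m IH]; rewrite ?cumul0 // cumulS; exact: tameU. Qed.

(** At a point outside the hull some competitor u witnesses this, and
    [separate_point] applies to it; continuity of the separators makes the
    property local, and their maxima make it stable under unions. *)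
Lemma tame_compact K : compact K -> K `<=` closure D -> (forall p, K p -> ~ H p) -> tame K.
Proof.
move=> cK KD KH e F e0 cF FH.
apply: (@compact_ind _ K (fun S => exists2 v, separator D F v &
    forall p, S p -> above D e v p)) => //.
- by exists (fun=> -1) => //; exact: separator_cst.
- by move=> S T ST [v sv vT]; exists v => // p /ST; exact: vT.
- move=> S T _ _ [v sv vS] [w sw wT].
  exists (fun x => Num.max (v x) (w x)); first exact: separator_max.
  by move=> p [/vS|/wT]; [exact: above_maxl|exact: above_maxr].
- move=> p Kp.
  have [u [pu idu u0 uA up]] : exists u, [/\ psh D u, not_identically_ninfty D u,
      forall w, D w -> (u w < 0)%E, forall w, A w -> usc_ext D u w = -oo%E & usc_ext D u p <> -oo%E].
    apply: contrapT => nu; apply: (KH p Kp); split; first exact: KD.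
    by move=> u pu idu u0 uA; apply: contrapT => up; apply: nu; exists u.
  have uF z : F z -> usc_ext D u z = -oo%E by move=> /FH[_]; apply.
  have [v sv vp] := separate_point n_gt0 D_reg cF pu u0 uF up e0.
  exists [set p' | above D e v p']; last by exists v; [exact: sv|move=> p' [_ ab]; exact: ab].
  exact: nbhs_interior vp.
Qed.

(** The negative function u - 1 competes in the definition of the hull, so the
    hull inside D is in its -oo set, which contains no ball. *)
Lemma hull_compl_dense z (r : R) : closure D z -> 0 < r ->
  exists p, [/\ D p, ~ H p & nrm (p - z) < r].
Proof.
move=> /closure_nrm cz r0.
have [_ [u [pu u0 [x0 Dx0 ux0] uA]]] := A_pp.
pose u1 x := (u x - 1)%E.
have pu1 : psh D u1 by exact: psh_sub1.
have u1E x : (u1 x == -oo%E) = (u x == -oo%E) by rewrite /u1; case: (u x).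
apply: contrapT => np.
have [d Dd dz] := cz r r0.
have H1 x : D x -> nrm (x - z) < r -> u x = -oo%E.
  move=> Dx xz; apply/eqP; rewrite -u1E -leeNy_eq.
  have Hx : H x by apply: contrapT => nHx; apply: np; exists x.
  have <- : usc_ext D u1 x = -oo%E.
    case: Hx => _; apply=> //.
    - by exists x0 => //; rewrite u1E.
    - by move=> w Dw; rewrite lteBlDr // add0e (le_lt_trans (u0 w Dw)) // lte_fin.
    - move=> w Aw; apply/eqP; rewrite -leeNy_eq -(uA w Aw).
      apply: le_ereal_inf_tmp => _ [V VD <-].
      apply: ge_ereal_inf; exists (ereal_sup (u1 @` V)); first by exists V.
      apply: ge_ereal_sup => _ [y Vy <-]; apply: (@le_trans _ _ (u y)).
        by rewrite leeBlDr // leeDl // lee_fin.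
      by apply: ereal_sup_ubound; exists y.
  exact: usc_ext_ge.
move/eqP: ux0; apply.
apply: (psh_ninfty_nbhs dD pu u0 Dd) => //.
have /nbhs_nrmP[s s0 Hs] : nbhs d D by exact: open_nbhs_nbhs.
have h1 := @nbhs_nrm _ _ d _ s0.
have rd : 0 < r - nrm (d - z) by rewrite subr_gt0.
have h2 := @nbhs_nrm _ _ d _ rd.
near=> y; apply: H1.
  by apply: Hs; near: y; exact: h1.
apply: le_lt_trans (nrm_triangle _ d _) _; rewrite -ltrBrDr; near: y; exact: h2.
Unshelve. all: by end_near. Qed.

(** These nets lie inside D, where plurisubharmonic functions have values, whereas
    the compact sets to be avoided may lie on the frontier. *)
Lemma tame_net (r : R) : 0 < r -> exists P, [/\ tame P, P `<=` D &
  forall z, closure D z -> exists2 p, P p & nrm (p - z) < r].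
Proof.
move=> r0.
apply: (@compact_ind _ (closure D) (fun S => exists P, [/\ tame P, P `<=` D &
  forall z, S z -> exists2 p, P p & nrm (p - z) < r])) => //.
- by exists set0; split=> //; exact: tame0.
- by move=> S T ST [P [tP PD Pz]]; exists P; split=> // z /ST; exact: Pz.
- move=> S T _ _ [P [tP PD Pz]] [Q [tQ QD Qz]]; exists (P `|` Q); split.
  + exact: tameU.
  + by move=> x [/PD|/QD].
  + move=> z [/Pz[p Pp pz]|/Qz[p Qp pz]]; first by exists p => //; left.
    by exists p => //; right.
- move=> z cz; have r2 : 0 < r / 2 by rewrite divr_gt0.
  have [p [Dp nHp pz]] := hull_compl_dense cz r2.
  exists [set y | nrm (y - z) < r / 2]; first exact: (nbhs_nrm z r2).
  exists [set p]; split.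
  + apply: tame_compact; first exact: compact_set1.
      by move=> _ ->; exact: subset_closure.
    by move=> _ ->.
  + by move=> _ ->.
  + move=> y [_ /= yz]; exists p => //.
    apply: le_lt_trans (nrm_triangle _ z _) _; rewrite (splitr r) ltrD //.
    by rewrite nrmB.
Qed.

End Tame.

(** * The series of separators *)

Section DecreasingLimit.
Context {R : realType} {n : nat}.
Local Notation X := 'rV[R[i]]_n.
Variables (D : set X) (S : nat -> X -> R).
Hypothesis bS : forall N, bpsh D (S N).
Hypothesis S0 : forall N x, D x -> S N x <= 0.
Hypothesis Sdec : forall N x, D x -> S N.+1 x <= S N x.

Definition seq_inf (x : X) : \bar R := ereal_inf (range (fun N => (S N x)%:E)).

Lemma seq_inf_le N x : (seq_inf x <= (S N x)%:E)%E.
Proof. by apply: ereal_inf_lbound; exists N. Qed.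

(** The submean inequality passes to decreasing limits by monotone convergence. *)
Lemma psh_seq_inf : psh D seq_inf.
Proof.
apply/pshP; split.
- move=> x Dx c /ereal_inf_lt[_ [N _ <-] Sc].
  apply: (@filterS _ (within D (nbhs x)) _ _ _ _ (bpsh_usc (bS N) Dx Sc)) => y.
  exact: le_lt_trans (seq_inf_le _ _).
- by move=> x Dx; apply: le_lt_trans (seq_inf_le 0 x) _; rewrite ltry.
- move=> x b Dxb; have Dx := disc_center Dxb.
  have Dt := disc_circle Dxb.
  have := seq_inf_le 0 x; case E : (seq_inf x) => [c||] // _; last by rewrite leNye.
  apply: (@emean_dec _ (fun N t => S N (x + expi t *: b))).
  + by move=> N; exact: bpsh_bmeas Dxb.
  + by move=> N t; exact: S0.
  + by move=> N t; exact: Sdec.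
  + move=> t; apply: ereal_nonincreasing_cvgn; apply/nonincreasing_seqP => N.
    by rewrite lee_fin; exact: Sdec.
  + move=> N; apply: le_trans (bpsh_mean (bS N) Dxb).
    by rewrite -lee_fin -E; exact: seq_inf_le.
Qed.
End DecreasingLimit.

Section Construction.
Context {R : realType} {n : nat}.
Local Notation X := 'rV[R[i]]_n.
Variables (D A : set X) (F K : nat -> set X).
Hypothesis n_gt0 : (0 < n)%N.
Hypothesis D_reg : B_regular D.
Hypothesis A_pp : b_pluripolar D A.
Local Notation H := (b_pluripolar_hull D A).
Hypothesis cF : forall i, compact (F i).
Hypothesis FH : forall i, F i `<=` H.
Hypothesis cK : forall i, compact (K i).
Hypothesis KD : forall i, K i `<=` closure D.
Hypothesis KH : forall i p, K i p -> ~ H p.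

Let eps (m : nat) : R := 2^-1 ^+ m.
Let eps_gt0 m : 0 < eps m.
Proof. by rewrite exprn_gt0 // invr_gt0. Qed.
Let eps_mono i j : (i <= j)%N -> eps j <= eps i.
Proof. by move=> ij; rewrite /eps ler_wiXn2l // ?invr_ge0 // invf_le1 // ler1n. Qed.
Let eps_sum N : \sum_(k < N) eps k <= 2.
Proof.
suff : \sum_(k < N) eps k + 2 * eps N = 2 by have := eps_gt0 N; lra.
elim: N => [|N IH]; first by rewrite big_ord0 add0r /eps expr0 mulr1.
rewrite big_ord_recr /= -addrA; have -> : eps N + 2 * eps N.+1 = 2 * eps N.
  by rewrite /eps exprS mulrA mulfV // mul1r mulr_natl mulr2n.
exact: IH.
Qed.

(** Bounding a sum of separators below near K l is not enough: each term is close
    to 0 only on its own neighborhood of K l, so the sum could be -oo in D near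
    a frontier point of K l. What is needed is a bound at points of D that
    accumulate at each point of K l. Such points are taken in the nets, and the
    terms of the sum are chosen sparsely enough: the l-th to k-th terms are close
    to 0 near K l, hence at some net point of bounded generation, and all later
    terms are close to 0 on the nets of that generation. *)
Lemma exhausting_psh : exists psi : X -> \bar R, [/\ psh D psi,
  forall x, D x -> (psi x < 0)%E,
  forall i z, F i z -> usc_ext D psi z = -oo%E &
  forall i z, K i z -> usc_ext D psi z <> -oo%E].
Proof.
have /boolp.choice[P HP] : forall k, exists P, [/\ tame D A P, P `<=` D &
    forall z, closure D z -> exists2 p, P p & nrm (p - z) < k.+1%:R^-1].
  by move=> k; apply: (tame_net n_gt0 D_reg A_pp); rewrite invr_gt0.
have tP m : tame D A (cumul K m `|` cumul P m).
  apply: tameU; last by apply: tame_cumul => i; have [] := HP i.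
  by apply: tame_cumul => i; exact: (tame_compact n_gt0 D_reg (@cK i) (@KD i) (@KH i)).
have /boolp.choice[v Hv] : forall m, exists w, separator D (cumul F m) w /\
    forall p, (cumul K m `|` cumul P m) p -> above D (eps m) w p.
  move=> m.
  have [|v sv vp] := tP m (eps m) (cumul F m) (eps_gt0 m) (@compact_cumul _ F m cF).
    by move=> z [i _ /FH].
  by exists v.
have sep m : separator D (cumul F m) (v m) by have [] := Hv m.
have v01 m x : D x -> -1 <= v m x <= 0 by have [_ _ h _] := sep m; exact: h.
have aK m l z : (l <= m)%N -> cumul K l z -> above D (eps m) (v m) z.
  by move=> lm Kz; have [_ h] := Hv m; apply: h; left; exact: cumul_mono Kz.
have aP m i p : (i <= m)%N -> P i p -> - eps m < v m p.
  move=> im Pp; have [_ h] := Hv m.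
  have Dp : D p by have [_ PD _] := HP i; exact: PD.
  have ab : above D (eps m) (v m) p by apply: h; right; exists i.
  exact: (nbhs_singleton ab).
have netM m l : exists M : nat, forall z, cumul K l z -> exists i p, [/\ (i <= M)%N, P i p,
    nrm (p - z) < m.+1%:R^-1 & forall j, (l <= j <= m)%N -> - eps j < v j p].
  apply: (@compact_ind _ (cumul K l) (fun S => exists M : nat, forall z, S z ->
    exists i p, [/\ (i <= M)%N, P i p, nrm (p - z) < m.+1%:R^-1 &
      forall j, (l <= j <= m)%N -> - eps j < v j p])).
  - exact: compact_cumul.
  - by exists 0%N.
  - by move=> S T ST [M HM]; exists M => z /ST; exact: HM.
  - move=> S T _ _ [M HM] [M' HM']; exists (maxn M M') => z [/HM|/HM'] [i [p [iM *]]];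
      by exists i, p; split=> //; rewrite leq_max iM ?orbT.
  - move=> z Kz.
    have [s0 s00 Hs] : exists2 s0 : R, 0 < s0 & forall s, 0 < s -> s < s0 -> forall j, (j < m.+1)%N ->
        (l <= j)%N -> forall p, D p -> nrm (p - z) < s -> - eps j < v j p.
      apply: common_threshold => j jm; have [lj|jl] := leqP l j; last by exists 1.
      have /nbhs_nrmP[s s_gt0 Hs] := aK j l z lj Kz.
      exists s => // s' s'0 ss _ p Dp pz; apply: Hs => //; exact: lt_trans ss.
    pose r := Num.min (s0 / 2) m.+1%:R^-1.
    have r0 : 0 < r by rewrite lt_min divr_gt0 //= invr_gt0.
    have rs : r < s0.
      by apply: (@le_lt_trans _ _ (s0 / 2)); rewrite ?ge_min ?lexx // ltr_pdivrMr // ltr_pMr // ltr1n.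
    have r2 : 0 < r / 2 by rewrite divr_gt0.
    have [i ir] : exists i : nat, i.+1%:R^-1 < r / 2.
      by have [i _ Hi] := @near_infty_natSinv_lt R (PosNum r2); exists i; apply: (Hi i) => /=.
    have cz : closure D z by have [k _ /KD] := Kz.
    have [_ PD /(_ z cz)[p Pp pz]] := HP i.
    exists [set y | nrm (y - z) < r / 2]; first exact: (nbhs_nrm z r2).
    exists i => y [Ky /= yz]; exists i, p; split=> //.
    + apply: (@lt_le_trans _ _ r); last by rewrite /r ge_min lexx orbT.
      apply: le_lt_trans (nrm_triangle _ z _) _; rewrite (splitr r) ltrD //.
        exact: lt_trans ir.
      by rewrite nrmB.
    + move=> j /andP[lj jm]; apply: (Hs r r0 rs j) => //; first exact: PD.
      apply: lt_trans pz _; apply: lt_trans ir _.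
      by rewrite ltr_pdivrMr // ltr_pMr // ltr1n.
have /boolp.choice[M HM] : forall m, exists M : nat, forall l z, (l <= m)%N -> cumul K l z ->
    exists i p, [/\ (i <= M)%N, P i p, nrm (p - z) < m.+1%:R^-1 &
      forall j, (l <= j <= m)%N -> - eps j < v j p].
  move=> m; have /boolp.choice[Ml HMl] := netM m.
  exists (\max_(l < m.+1) Ml l)%N => l z lm Kz.
  have [i [p [h1 h2 h3 h4]]] := HMl l z Kz.
  exists i, p; split=> //; apply: leq_trans h1 _.
  exact: (@leq_bigmax _ (fun l : 'I_m.+1 => Ml l) (Ordinal (lm : (l < m.+1)%N))).
(* M m bounds the generations of the net points that serve K 0, ..., K m at stage
   m; the next index must reach these generations. *)
pose mk k := iter k (fun m => maxn m.+1 (M m)) 0%N.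
have mkS k : (mk k < mk k.+1)%N by rewrite /mk iterS leq_max leqnn.
have mkM k : (M (mk k) <= mk k.+1)%N by rewrite /mk iterS leq_max leqnn orbT.
have mk_mono : {homo mk : i j / (i <= j)%N}.
  by apply: (homo_leq leqnn leq_trans) => k; exact: ltnW (mkS k).
have mk_ge k : (k <= mk k)%N by elim: k => // k IH; exact: leq_ltn_trans (mkS k).
pose S N x := -1 + \sum_(k < N) v (mk k) x.
have SS N x : S N.+1 x = S N x + v (mk N) x by rewrite /S big_ord_recr /= addrA.
have bv m : bpsh D (v m).
  have [pv _ _ _] := sep m; split=> //; exists 1 => x /(v01 m)/andP[h1 h2].
  by rewrite ler_norml h1 (le_trans h2).
have bS N : bpsh D (S N).
  elim: N => [|N IH].
    have -> : S 0%N = (fun=> -1) by apply/funext => x; rewrite /S big_ord0 addr0.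
    exact: bpsh_cst.
  have -> : S N.+1 = (fun x => S N x + v (mk N) x) by apply/funext => x; exact: SS.
  exact: bpshD.
have Sdec N x : D x -> S N.+1 x <= S N x.
  by move=> Dx; rewrite SS gerDl; have /andP[] := v01 (mk N) x Dx.
have S_le N x : D x -> S N x <= -1.
  move=> Dx; elim: N => [|N IH]; first by rewrite /S big_ord0 addr0.
  exact: le_trans (Sdec N x Dx) IH.
have S0 N x : D x -> S N x <= 0 by move=> Dx; rewrite (le_trans (S_le N x Dx)).
exists (seq_inf S); split.
- exact: psh_seq_inf bS S0 Sdec.
- move=> x Dx; apply: le_lt_trans (seq_inf_le S 0 x) _.
  by rewrite lte_fin (le_lt_trans (S_le _ _ Dx)).
- move=> i z Fz.
  have nearS N : \forall y \near within D (nbhs z), S (i + N)%N y <= - (N%:R / 2).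
    elim: N => [|N IH].
      by rewrite mul0r oppr0; apply: (@filterE _ (nbhs z)) => y Dy; exact: S0.
    have Fmk : cumul F (mk (i + N)%N) z.
      by exists i => //; apply: leq_trans (mk_ge _); exact: leq_addr.
    have [_ _ _ /(_ z Fmk) vz] := sep (mk (i + N)%N).
    near=> y; rewrite addnS SS.
    have h1 : S (i + N)%N y <= - (N%:R / 2) by near: y; exact: IH.
    have h2 : v (mk (i + N)%N) y < - 2^-1 by near: y; exact: vz.
    by rewrite -natr1 mulrDl; lra.
  suff usc_le (c : R) : (usc_ext D (seq_inf S) z <= c%:E)%E.
    case: (usc_ext _ _ _) usc_le => [r /(_ (r - 1))|/(_ 0)|//]; last by rewrite leye_eq.
    by rewrite lee_fin lerBrDr gerDl ler10.
  have [N cN] : exists N : nat, - (N%:R / 2) <= c.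
    exists (Num.truncn (2 * `|c|)).+1.
    have : 2 * `|c| < (Num.truncn (2 * `|c|)).+1%:R by apply: truncnS_gt.
    have := ler_norm (- c); rewrite normrN; lra.
  apply: usc_ext_le; apply: (filterS _ (nearS N)) => y Sy.
  by apply: le_trans (seq_inf_le S (i + N)%N y) _; rewrite lee_fin (le_trans Sy).
- move=> l z Kz psiz.
  have : (usc_ext D (seq_inf S) z < (- (l%:R + 4))%:E)%E by rewrite psiz ltNyr.
  move=> /usc_ext_lt/nbhs_nrmP[r r0 Hr].
  have [k [lk kr]] : exists k, (l <= k)%N /\ (mk k).+1%:R^-1 < r.
    have [k0 _ Hk0] := @near_infty_natSinv_lt R (PosNum r0).
    exists (maxn l k0); split; first exact: leq_maxl.
    by apply: (Hk0 (mk _)) => /=; apply: leq_trans (mk_ge _); exact: leq_maxr.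
  have Kl : cumul K l z by exists l.
  have [i [p [iM Pp pz pv]]] := HM (mk k) l z (leq_trans lk (mk_ge k)) Kl.
  have Dp : D p by have [_ PD _] := HP i; exact: PD.
  have := Hr p (lt_trans pz kr) Dp.
  rewrite ltNge => /negP; apply; apply: le_ereal_inf_tmp => _ [N _ <-].
  rewrite lee_fin.
  (* The first l terms are only bounded by 1; the others are at least - eps j, by
     the choice of p up to stage k and by the generation of p afterwards. *)
  have vge j : - ((j < l)%N%:R + eps j) <= v (mk j) p.
    have [jl|lj] := ltnP j l.
      have /andP[h _] := v01 (mk j) p Dp; have := eps_gt0 j; rewrite /=; lra.
    have : - eps (mk j) < v (mk j) p.
      have [jk|kj] := leqP j k.
        by apply: pv; rewrite (leq_trans lj (mk_ge j)) mk_mono.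
      apply: (aP _ i) => //; apply: leq_trans iM _; apply: leq_trans (mkM k) _.
      exact: mk_mono.
    have := eps_mono (mk_ge j); rewrite /=; lra.
  have count : \sum_(j < N) ((j < l)%N%:R : R) <= l%:R.
    rewrite -natr_sum ler_nat.
    have -> : (\sum_(j < N) (j < l) = minn N l)%N.
      elim: N => [|N IH]; first by rewrite big_ord0 min0n.
      by rewrite big_ord_recr /= IH; case: ltnP => Nl; lia.
    exact: geq_minr.
  have : - (\sum_(j < N) ((j < l)%N%:R + eps j)) <= \sum_(j < N) v (mk j) p.
    by rewrite -sumrN; apply: ler_sum => j _; exact: vge.
  rewrite big_split /= /S; have := eps_sum N; lra.
Unshelve. all: by end_near. Qed.

End Construction.

Unset Implicit Arguments.

Theorem theorem4p4 (R : realType) (n : nat) (n_gt0 : (0 < n)%N)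
    (D A F G : set 'rV[R[i]]_n)
    (D_reg : B_regular D)
    (A_front : A `<=` frontier D) (A_pp : b_pluripolar D A)
    (F_clos : F `<=` closure D) (F_Fsigma : Fsigma F)
    (G_clos : G `<=` closure D) (G_Gdelta : Gdelta G)
    (F_hull : F `<=` b_pluripolar_hull D A)
    (hull_G : b_pluripolar_hull D A `<=` G) :
  exists (E : set 'rV[R[i]]_n) (psi : 'rV[R[i]]_n -> \bar R),
    [/\ psh D psi,
        forall z, D z -> (psi z < 0)%E,
        F `<=` E,
        E `<=` G &
        E = [set z | closure D z /\ usc_ext D psi z = -oo%E]].
Proof.
have [Fi cFi FE] := F_Fsigma; have [Oi oOi GE] := G_Gdelta.
have cD : compact (closure D) by apply: bounded_closure_compact; have [] := D_reg.
have subF i : Fi i `<=` F by rewrite FE => x Fx; exists i.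
have cF i : compact (Fi i).
  by apply: subclosed_compact (cFi i) cD _; exact: subset_trans (subF i) F_clos.
pose K i := closure D `&` ~` Oi i.
have cK i : compact (K i).
  apply: subclosed_compact _ cD _; last by move=> x [].
  by apply: closedI; [exact: closed_closure | exact: open_closedC].
have KH i p : K i p -> ~ b_pluripolar_hull D A p.
  by move=> [_ nO] /hull_G; rewrite GE => /(_ i I).
have [psi [p1 p2 p3 p4]] := exhausting_psh n_gt0 D_reg A_pp cF
  (fun i => subset_trans (subF i) F_hull) cK (fun i x (Kx : K i x) => Kx.1) KH.
exists [set z | closure D z /\ usc_ext D psi z = -oo%E], psi; split=> //.
  move=> z Fz; split; first exact: F_clos.
  by move: Fz; rewrite FE => -[i _ /p3].
move=> z [cz pz]; rewrite GE => i _; apply: contrapT => nO.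
by apply: (p4 i z) => //; split.
Qed.
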